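(* Let $\mathcal{D}=(G,\chi,z,\lambda,q)$, $n$, $p=\chi(z)$ and $H_{\mathcal{D}}$ be as in the context, with $(p,q)\neq(1,-1)$. Let $(B,s)$ be a right $H_{\mathcal{D}}$-comodule algebra, with associated subspaces $B_{g,\zeta}$ and maps $\alpha,U\colon B\to B$, and let $C:=B^{\mathrm{coH}_{\mathcal{D}}}$. The extension $(C\hookrightarrow B,s)$ is cleft if and only if there exist $b_x\in B$ and a family $(b_g)_{g\in G}$ of elements of $B^{\times}$ such that (a) $b_g\in B_{g,\mathrm{id}}\cap\ker(U)$ for all $g\in G$, (b) $b_x\in B_{z,\mathrm{id}}\cap U^{-1}(1_B)$, (c) $\alpha(b_x)=q\,b_x$, (d) $\alpha(b_g)=b_g$ for all $g\in G$. If this is the case, then the map $\gamma\colon H_{\mathcal{D}}\to B$ defined by $\gamma(gx^i):=b_gb_x^i$ ($g\in G$, $0\le i<n$) is a cleft map, and its convolution inverse is given by $$\gamma^{-1}(gx^i)=(-1)^i(qp)^{\frac{i(i-1)}{2}}b_x^i\,b_{gz^i}^{-1}.$$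
   Context: $k$ is a field, all maps are $k$-linear, $\otimes=\otimes_k$, algebras are associative unital, and the name of a space also denotes its identity map. For $t\in k$, $(j)_t=\sum_{i=0}^{j-1}t^i$ and $(j)!_t=(1)_t(2)_t\cdots(j)_t$. Data: $G$ is a finite group, $\chi\colon G\to k^\times$ a character, $z\in G$ central, $q\in k^\times$, $\lambda\in k$, $p:=\chi(z)$; $qp$ is a root of $1$ of order $n>1$; and $\chi^n=1$ if $\lambda(z^n-1_G)\ne0$. $H_{\mathcal D}$ is the braided Hopf algebra generated as an algebra by the group $G$ and an element $x$ with relations $x^n=\lambda(z^n-1_G)$, $xg=\chi(g)gx$ ($g\in G$); it has basis $\{gx^i:g\in G,0\le i<n\}$, comultiplication and counit determined by $\Delta(g)=g\otimes g$, $\Delta(x)=1\otimes x+x\otimes z$, $\epsilon(g)=1$, $\epsilon(x)=0$, and braid $c=c_q$, $c_q(gx^i\otimes hx^j)=q^{ij}hx^j\otimes gx^i$. (As in any braided bialgebra, $\Delta\mu=(\mu\otimes\mu)(H\otimes c\otimes H)(\Delta\otimes\Delta)$.) $\mathrm{Aut}_{\chi,z}(G)$ is the group of automorphisms $\phi$ of $G$ with $\phi(z)=z$ and $\chi\circ\phi=\chi$. For a braided bialgebra $H$ with braid $c$, a left transposition of $H$ on an algebra $B$ is a bijective map $s\colon H\otimes B\to B\otimes H$ such that: $s(1_H\otimes b)=b\otimes1_H$; $s\circ(\mu_H\otimes B)=(B\otimes\mu_H)\circ(s\otimes H)\circ(H\otimes s)$; $(B\otimes\epsilon)\circ s=\epsilon\otimes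 B$; $(B\otimes\Delta)\circ s=(s\otimes H)\circ(H\otimes s)\circ(\Delta\otimes B)$; $(s\otimes H)\circ(H\otimes s)\circ(c\otimes B)=(B\otimes c)\circ(s\otimes H)\circ(H\otimes s)$; $s(h\otimes1_B)=1_B\otimes h$; $s\circ(H\otimes\mu_B)=(\mu_B\otimes H)\circ(B\otimes s)\circ(s\otimes B)$. A right $H$-comodule algebra $(B,s)$ is an algebra $B$ with an ordinary right $H$-comodule structure $\nu\colon B\to B\otimes H$ and a left transposition $s$ of $H$ on $B$ such that $(\nu\otimes H)\circ s=(B\otimes c)\circ(s\otimes H)\circ(H\otimes\nu)$, $\nu\circ\mu_B=(\mu_B\otimes\mu_H)\circ(B\otimes s\otimes H)\circ(\nu\otimes\nu)$ and $\nu(1_B)=1_B\otimes1_H$. Put $B^{\mathrm{coH}}=\{b\in B:\nu(b)=b\otimes1_H\}$ (a subalgebra). Associated objects: for a right $H_{\mathcal D}$-comodule algebra $(B,s)$, there are (under the standing assumption $(p,q)\ne(1,-1)$) a unique vector space decomposition $B=\bigoplus_{(g,\zeta)\in G\times\mathrm{Aut}_{\chi,z}(G)}B_{g,\zeta}$, a unique algebra automorphism $\alpha$ of $B$ and a unique linear map $U\colon B\to B$ with $\alpha(B_{g,\zeta})=B_{g,\zeta}$, $U(B_{g,\zeta})\subseteq B_{z^{-1}g,\zeta}$, $U^n=0$, $U\circ\alpha=q\,\alpha\circ U$, such that $s(gx^i\otimes b)=\alpha^i(b)\otimes\zeta(g)x^i$ for $b\in\bigoplus_hB_{h,\zeta}$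 and $\nu(b)=\sum_{i=0}^{n-1}\frac1{(i)!_{qp}}U^i(b)\otimes z^{-i}gx^i$ for $b\in B_g:=\bigoplus_\zeta B_{g,\zeta}$. Explicitly, writing $\nu(b)=\sum_{g,i}U^g_i(b)\otimes gx^i$, one has $B_{g,\zeta}=U^g_0(B)\cap\{b:s(h\otimes b)=b\otimes\zeta(h)\ \forall h\in G\}$, $U=\sum_gU^g_1$, and $s(x\otimes b)=\alpha(b)\otimes x$. The extension $(C\hookrightarrow B,s)$ is cleft if there is a cleft map, i.e. a right $H_{\mathcal D}$-colinear map $\gamma\colon H_{\mathcal D}\to B$ that is invertible for the convolution product $f*g=\mu_B\circ(f\otimes g)\circ\Delta$ and satisfies $(\gamma\otimes H_{\mathcal D})\circ c_q=s\circ(H_{\mathcal D}\otimes\gamma)$. $B^\times$ is the group of units of $B$. *)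

(* Defs.v *)
From HB Require Import structures.
From mathcomp Require Import all_boot all_fingroup all_algebra.

Set Implicit Arguments.
Unset Strict Implicit.
Unset Printing Implicit Defensive.

Import GRing.Theory.
Local Open Scope ring_scope.

(* The data (G, chi, z, lambda, q, n); G is the whole of gT.  Since z^n and 1
   are basis elements of k[G], lambda (z^n - 1) <> 0 says that lambda <> 0 and
   z^n <> 1. *)
Record datum (k : fieldType) (gT : finGroupType) := Datum {
  chi : gT -> k;
  zc : gT;
  lam : k;
  qq : k;
  ord : nat;
  chi1 : chi 1%g = 1;
  chiM : forall g h : gT, chi (g * h)%g = chi g * chi h;
  zc_central : forall g : gT, (zc * g = g * zc)%g;
  qq_neq0 : qq != 0;
  ord_gt1 : (1 < ord)%N;
  qp_prim : ord.-primitive_root (qq * chi zc);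
  chi_ord : lam != 0 -> (zc ^+ ord != 1)%g -> forall g, chi g ^+ ord = 1
}.

Definition dlt (k : fieldType) (J : finType) (a : J) : {ffun J -> k^o} :=
  [ffun b => (a == b)%:R].

Section Algebra.
Variables (k : fieldType) (gT : finGroupType) (D : datum k gT).

Local Notation n := (ord D).
Local Notation z := (zc D).

Definition pp : k := chi D z.

Lemma ord_gt0 : (0 < n)%N. Proof. exact: ltnW (ord_gt1 D). Qed.

(* (g, i) is the index of the basis element g x^i. *)
Definition idx : finType := (gT * 'I_n)%type.

Definition HD : Type := {ffun idx -> k^o}.
HB.instance Definition _ := GRing.Lmodule.copy HD {ffun idx -> k^o}.

Definition hbas (a : idx) : HD := dlt k a.

(* g x^m for arbitrary m, written in the basis by means of
   x^n = lambda (z^n - 1): nfr c g i is g x^(c n + i). *)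
Fixpoint nfr (c : nat) (g : gT) (i : 'I_n) : HD :=
  if c is c'.+1 then lam D *: (nfr c' (g * z ^+ n)%g i - nfr c' g i)
  else hbas (g, i).
Definition nform (g : gT) (m : nat) : HD :=
  nfr (m %/ n) g (Ordinal (ltn_pmod m ord_gt0)).

(* (g x^i)(h x^j) = chi(h)^i g h x^(i+j) *)
Definition hmul_bas (a b : idx) : HD :=
  chi D b.1 ^+ a.2 *: nform (a.1 * b.1)%g (a.2 + b.2)%N.
Definition hmul (u v : HD) : HD :=
  \sum_a \sum_b ((u : {ffun idx -> k^o}) a * (v : {ffun idx -> k^o}) b)
                *: hmul_bas a b.

Lemma nform_small g (i : 'I_n) : nform g i = hbas (g, i).
Proof.
rewrite /nform divn_small //=; congr (hbas (_, _)).
by apply: val_inj; rewrite /= modn_small.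
Qed.

Lemma nform_big g m :
  nform g (m + n) = lam D *: (nform (g * z ^+ n)%g m - nform g m).
Proof.
rewrite /nform -{1}(mul1n n) addnC divnMDl ?ord_gt0 // add1n /=.
by set i := Ordinal _; set j := Ordinal _; have -> : i = j
  by apply: val_inj; rewrite /= modnDr.
Qed.

Fact hmul_is_additive_l v : {morph hmul^~ v : u w / u + w}.
Proof.
move=> u w; rewrite /hmul -big_split; apply: eq_bigr => a _ /=.
rewrite -big_split; apply: eq_bigr => b _ /=.
by rewrite ffunE mulrDl scalerDl.
Qed.
Fact hmul_is_additive_r u : {morph hmul u : v w / v + w}.
Proof.
move=> v w; rewrite /hmul -big_split; apply: eq_bigr => a _ /=.
rewrite -big_split; apply: eq_bigr => b _ /=.
by rewrite ffunE mulrDr scalerDl.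
Qed.
Fact hmulZl c u v : c *: hmul u v = hmul (c *: u) v.
Proof.
rewrite /hmul scaler_sumr; apply: eq_bigr => a _.
rewrite scaler_sumr; apply: eq_bigr => b _.
by rewrite ffunE scalerA mulrA.
Qed.
Fact hmulZr c u v : c *: hmul u v = hmul u (c *: v).
Proof.
rewrite /hmul scaler_sumr; apply: eq_bigr => a _.
rewrite scaler_sumr; apply: eq_bigr => b _.
by rewrite ffunE scalerA mulrCA.
Qed.
Fact hmul0l v : hmul 0 v = 0.
Proof. by apply: (addIr (hmul 0 v)); rewrite -hmul_is_additive_l !add0r. Qed.
Fact hmul0r v : hmul v 0 = 0.
Proof. by apply: (addIr (hmul v 0)); rewrite -hmul_is_additive_r !add0r. Qed.
Fact hmulNl u v : hmul (- u) v = - hmul u v.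
Proof. by rewrite -scaleN1r -hmulZl scaleN1r. Qed.
Fact hmulNr u v : hmul u (- v) = - hmul u v.
Proof. by rewrite -scaleN1r -hmulZr scaleN1r. Qed.

Fact hmul_sumZl (I : Type) (r : seq I) (f : I -> HD) c v :
  hmul (\sum_(a <- r) c a *: f a) v = \sum_(a <- r) c a *: hmul (f a) v.
Proof.
rewrite (big_morph _ (hmul_is_additive_l v) (hmul0l v)).
by apply: eq_bigr => a _; rewrite hmulZl.
Qed.
Fact hmul_sumZr (I : Type) (r : seq I) (f : I -> HD) c v :
  hmul v (\sum_(a <- r) c a *: f a) = \sum_(a <- r) c a *: hmul v (f a).
Proof.
rewrite (big_morph _ (hmul_is_additive_r v) (hmul0r v)).
by apply: eq_bigr => a _; rewrite hmulZr.
Qed.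

Lemma hbas_sum (u : HD) : u = \sum_a (u : {ffun idx -> k^o}) a *: hbas a.
Proof.
apply/ffunP => b; rewrite sum_ffunE (bigD1 b) //= big1 => [|a nab].
  by rewrite !ffunE eqxx addr0 /GRing.scale /= mulr1.
by rewrite !ffunE (negPf nab) scaler0.
Qed.

Lemma hmul_basE a b : hmul (hbas a) (hbas b) = hmul_bas a b.
Proof.
rewrite /hmul (bigD1 a) //= [X in _ + X]big1 ?addr0 => [|c nca].
  rewrite (bigD1 b) //= [X in _ + X]big1 ?addr0 => [|c ncb].
    by rewrite !ffunE !eqxx mulr1 scale1r.
  by rewrite !ffunE [b == c]eq_sym (negPf ncb) mulr0 scale0r.
by apply: big1 => d _; rewrite ffunE eq_sym (negPf nca) mul0r scale0r.
Qed.

Lemma lam_zn : lam D = 0 \/ (z ^+ n = 1)%g \/ forall g, chi D g ^+ n = 1.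
Proof.
have [|lam0] := eqVneq (lam D) 0; first by left.
have [|zn1] := eqVneq (z ^+ n)%g 1%g; first by right; left.
by right; right; apply: chi_ord.
Qed.

Lemma nform_bigE g m : nform g (m + n) = 0 \/
  nform g (m + n) = lam D *: (nform (g * z ^+ n)%g m - nform g m)
  /\ forall g, chi D g ^+ n = 1.
Proof.
rewrite nform_big; case: lam_zn => [->|[->|h]]; [left|left|right=> //].
  by rewrite scale0r.
by rewrite mulg1 subrr scaler0.
Qed.

Lemma chiX g m : chi D (g ^+ m)%g = chi D g ^+ m.
Proof. by elim: m => [|m IH]; rewrite ?expg0 ?chi1 // expgS exprS chiM IH. Qed.

Lemma znC g : (z ^+ n * g = g * z ^+ n)%g.
Proof. by apply/esym/commuteX; rewrite /commute zc_central. Qed.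

Lemma hmul_nform g h i j :
  hmul (nform g i) (nform h j) = chi D h ^+ i *: nform (g * h)%g (i + j)%N.
Proof.
have [m] := ubnP (i + j); elim: m g h i j => // m IH g h i j; rewrite ltnS => lm.
have [lti|lei] := ltnP i n; last first.
  have ltm : (i - n + j < m)%N.
    by apply: leq_trans lm; rewrite ltn_add2r ltn_subrL ord_gt0
               (leq_trans ord_gt0 lei).
  rewrite -{1}(subnK lei) nform_big -hmulZl hmul_is_additive_l hmulNl !IH //.
  have -> : (i + j = i - n + j + n)%N by rewrite addnAC subnK.
  have -> : chi D h ^+ i = chi D h ^+ (i - n) * chi D h ^+ n.
    by rewrite -exprD subnK.
  rewrite nform_big -!mulgA znC !mulgA -scalerBr !scalerA.
  case: lam_zn => [->|[->|->]]; first by rewrite mulr0 mul0r !scale0r.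
    by rewrite mulg1 subrr !scaler0.
  by rewrite mulr1 mulrC.
have [ltj|lej] := ltnP j n; last first.
  have ltm : (i + (j - n) < m)%N.
    by apply: leq_trans lm; rewrite ltn_add2l ltn_subrL ord_gt0
               (leq_trans ord_gt0 lej).
  rewrite -{1}(subnK lej) nform_big -hmulZr hmul_is_additive_r hmulNr !IH //.
  have -> : (i + j = i + (j - n) + n)%N by rewrite -addnA subnK.
  rewrite nform_big mulgA.
  case: lam_zn => [->|[->|hn]]; first by rewrite !scale0r scaler0.
    by rewrite !mulg1 !subrr !scaler0.
  by rewrite chiM chiX hn mulr1 -scalerBr !scalerA mulrC.
rewrite -[i]/(nat_of_ord (Ordinal lti)) -[j]/(nat_of_ord (Ordinal ltj)).
by rewrite !nform_small hmul_basE.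
Qed.

Lemma hbasE a : hbas a = nform a.1 a.2.
Proof. by case: a => g i; rewrite nform_small. Qed.

Fact hmulA : associative hmul.
Proof.
move=> u v w; rewrite (hbas_sum u) !hmul_sumZl; apply: eq_bigr => a _.
congr (_ *: _); rewrite (hbas_sum v) hmul_sumZr !hmul_sumZl hmul_sumZr.
apply: eq_bigr => b _; congr (_ *: _).
rewrite (hbas_sum w) !hmul_sumZr; apply: eq_bigr => c _; congr (_ *: _).
rewrite !hbasE !hmul_nform -hmulZl -hmulZr !hmul_nform !scalerA chiM mulgA addnA.
by rewrite exprD exprMn; congr (_ *: _); rewrite mulrC -mulrA.
Qed.

Fact hmul1l : left_id (nform 1%g 0) hmul.
Proof.
move=> v; rewrite {2}(hbas_sum v) [in LHS](hbas_sum v) hmul_sumZr.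
apply: eq_bigr => a _.
by rewrite !hbasE hmul_nform expr0 scale1r mul1g add0n.
Qed.
Fact hmul1r : right_id (nform 1%g 0) hmul.
Proof.
move=> v; rewrite {2}(hbas_sum v) [in LHS](hbas_sum v) hmul_sumZl.
apply: eq_bigr => a _.
by rewrite !hbasE hmul_nform chi1 expr1n scale1r mulg1 addn0.
Qed.
Fact hmulDl : left_distributive hmul +%R.
Proof. by move=> u w v; apply: hmul_is_additive_l. Qed.
Fact hone_neq0 : nform 1%g 0 != 0.
Proof.
rewrite -[0%N]/(nat_of_ord (Ordinal ord_gt0)) nform_small.
apply/eqP => /ffunP/(_ (1%g, Ordinal ord_gt0)) /eqP.
by rewrite !ffunE eqxx oner_eq0.
Qed.

HB.instance Definition _ := GRing.Zmodule_isNzRing.Build HD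
  hmulA hmul1l hmul1r hmulDl hmul_is_additive_r hone_neq0.
HB.instance Definition _ := GRing.Lmodule_isLalgebra.Build k HD hmulZl.
HB.instance Definition _ := GRing.Lalgebra_isAlgebra.Build k HD hmulZr.

Definition hg (g : gT) : HD := nform g 0.
Definition hx : HD := nform 1%g 1.

Lemma hgM g h : hg g * hg h = hg (g * h)%g.
Proof. by rewrite [LHS]hmul_nform expr0 scale1r. Qed.
Lemma hg1 : hg 1%g = 1. Proof. by []. Qed.
Lemma hx_hg g : hx * hg g = chi D g *: (hg g * hx).
Proof.
rewrite [hg g * hx]hmul_nform [LHS]hmul_nform expr0 scale1r expr1.
by rewrite mul1g mulg1.
Qed.
Lemma hg_hxX g i : hg g * hx ^+ i = nform g i.
Proof.
elim: i => [|i IH]; first by rewrite expr0 mulr1.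
by rewrite exprSr mulrA IH [LHS]hmul_nform chi1 expr1n scale1r mulg1 addn1.
Qed.
Lemma hbas_hg_hx (a : idx) : hbas a = hg a.1 * hx ^+ a.2.
Proof. by rewrite hg_hxX hbasE. Qed.
Lemma hx_ord : hx ^+ n = lam D *: (hg (z ^+ n)%g - 1).
Proof.
by rewrite -[LHS]mul1r -hg1 hg_hxX -[n in nform _ n]add0n nform_big mul1g.
Qed.
End Algebra.

(* H_D has a finite basis indexed by idx D, so V (x) H_D and H_D (x) V are both
   taken to be {ffun idx D -> V}, the value at a being the coefficient of the
   a-th basis element (tens_univ is the universal property).  Likewise
   {ffun idx D * idx D -> V} stands for each of H_D (x) H_D (x) V,
   H_D (x) V (x) H_D and V (x) H_D (x) H_D, the pair listing the two H_D-legs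
   from left to right.  A tensor product of the form B (x) B only occurs as the
   source of an identity, which is then stated on pure tensors b (x) b'. *)
Section Tensor.
Variables (k : fieldType) (gT : finGroupType) (D : datum k gT).

Local Notation I := (idx D).
Local Notation I2 := (idx D * idx D)%type.
Local Notation H := (HD D).
Local Notation HH := {ffun I2 -> k^o}.
Local Notation ev h := (h : {ffun I -> k^o}).

(* h (x) v and v (x) h *)
Definition tHV (V : lmodType k) (h : H) (v : V) : {ffun I -> V} :=
  [ffun a => ev h a *: v].
Definition tVH (V : lmodType k) (v : V) (h : H) : {ffun I -> V} :=
  [ffun a => ev h a *: v].
Definition tHH (u v : H) : HH := [ffun ab => ev u ab.1 * ev v ab.2].

(* V (x) f (equivalently f (x) V) for a linear map f between tensor powers
   of H_D *)
Definition ampl (V : lmodType k) (J K : finType)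
    (f : {ffun J -> k^o} -> {ffun K -> k^o}) (t : {ffun J -> V}) :
    {ffun K -> V} :=
  [ffun y => \sum_x f (dlt k x) y *: t x].

Definition mulH (t : HH) : {ffun I -> k^o} :=
  \sum_(ab : I2) t ab *: (hbas ab.1 * hbas ab.2 : H).

Definition braidH (t : HH) : HH :=
  \sum_(ab : I2) (qq D ^+ (ab.1.2 * ab.2.2) * t ab) *: tHH (hbas ab.2) (hbas ab.1).

(* (mu (x) mu)(H (x) c (x) H) on t (x) u *)
Definition mulHH (t u : HH) : HH :=
  \sum_(ab : I2) \sum_(cd : I2) (t ab * u cd * qq D ^+ (ab.2.2 * cd.1.2))
    *: tHH (hbas ab.1 * hbas cd.1) (hbas ab.2 * hbas cd.2).

(* Delta(g x^i) = Delta(g) Delta(x)^i, in H_D (x) H_D with product mulHH *)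
Definition comul (u : {ffun I -> k^o}) : HH :=
  \sum_a u a *:
    mulHH (tHH (hg D a.1) (hg D a.1))
      (iter a.2 (mulHH^~ (tHH 1 (hx D) + tHH (hx D) (hg D (zc D))))
         (tHH 1 1)).

Definition counit (u : H) : k := \sum_(a | val a.2 == 0%N) ev u a.

Definition id_counit (V : lmodType k) (t : {ffun I -> V}) : V :=
  \sum_a counit (hbas a) *: t a.

(* f (x) H and H (x) f, for f = s : H (x) V -> V (x) H *)
Definition s_H (V : lmodType k) (s : {ffun I -> V} -> {ffun I -> V})
    (t : {ffun I2 -> V}) : {ffun I2 -> V} :=
  [ffun ab => s [ffun a => t (a, ab.2)] ab.1].
Definition H_s (V : lmodType k) (s : {ffun I -> V} -> {ffun I -> V})
    (t : {ffun I2 -> V}) : {ffun I2 -> V} :=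
  [ffun ab => s [ffun b => t (ab.1, b)] ab.2].

(* the same for f = nu : V -> V (x) H *)
Definition nu_H (V : lmodType k) (nu : V -> {ffun I -> V})
    (t : {ffun I -> V}) : {ffun I2 -> V} :=
  [ffun ab => nu (t ab.2) ab.1].
Definition H_nu (V : lmodType k) (nu : V -> {ffun I -> V})
    (t : {ffun I -> V}) : {ffun I2 -> V} :=
  [ffun ab => nu (t ab.1) ab.2].

(* the same for f = gamma : H -> V *)
Definition ga_H (V : lmodType k) (ga : H -> V) (t : HH) : {ffun I -> V} :=
  [ffun b => ga [ffun a => t (a, b)]].
Definition H_ga (V : lmodType k) (ga : H -> V) (t : HH) : {ffun I -> V} :=
  [ffun a => ga [ffun b => t (a, b)]].

Lemma mulHH_bas (a b c d : I) :
  mulHH (tHH (hbas a) (hbas b)) (tHH (hbas c) (hbas d)) =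
  qq D ^+ (b.2 * c.2) *: tHH (hbas a * hbas c) (hbas b * hbas d).
Proof.
have E (x y : I) (xy : I2) :
    tHH (hbas x) (hbas y) xy = (xy == (x, y))%:R.
  case: xy => x' y'; rewrite !ffunE /= xpair_eqE.
  by rewrite -natrM mulnb ![_ == x']eq_sym ![_ == y']eq_sym.
rewrite /mulHH (bigD1 (a, b)) //= [X in _ + X]big1 ?addr0 => [|x nx].
  rewrite (bigD1 (c, d)) //= [X in _ + X]big1 ?addr0 => [|y ny].
    by rewrite !E !eqxx !mul1r.
  by rewrite (E c d y) (negPf ny) mulr0 mul0r scale0r.
by apply: big1 => y _; rewrite (E a b x) (negPf nx) !mul0r scale0r.
Qed.

Lemma mulHH1t (t : HH) : mulHH (tHH 1 1) t = t.
Proof.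
have -> : (1 : H) = hbas (1%g, Ordinal (ord_gt0 D)).
  by rewrite hbas_hg_hx /= expr0 mulr1 hg1.
set e := (_, _) : I.
have E (xy : I2) : tHH (hbas e) (hbas e) xy = (xy == (e, e))%:R.
  case: xy => x' y'; rewrite !ffunE /= xpair_eqE.
  by rewrite -natrM mulnb ![_ == x']eq_sym ![_ == y']eq_sym.
rewrite /mulHH (bigD1 (e, e)) //= [X in _ + X]big1 ?addr0 => [|x nx].
  apply/ffunP => y; rewrite sum_ffunE (bigD1 y) //= big1 => [|x nx].
    rewrite E eqxx !mul1r mul0n expr0 mulr1.
    have e1 : hbas e = 1 by rewrite hbas_hg_hx /= expr0 mulr1 hg1.
    by rewrite !ffunE e1 !mul1r !ffunE !eqxx !mulr1 addr0 /GRing.scale /= mulr1.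
  have e1 : hbas e = 1 by rewrite hbas_hg_hx /= expr0 mulr1 hg1.
  case: y nx => y1 y2; case: x => x1 x2 nx; rewrite e1 !mul1r !ffunE /=.
  by rewrite -natrM mulnb -xpair_eqE (negPf nx) scaler0.
by apply: big1 => y _; rewrite E (negPf nx) !mul0r scale0r.
Qed.

Lemma mulHHt1 (t : HH) : mulHH t (tHH 1 1) = t.
Proof.
have -> : (1 : H) = hbas (1%g, Ordinal (ord_gt0 D)).
  by rewrite hbas_hg_hx /= expr0 mulr1 hg1.
set e := (_, _) : I.
have E (xy : I2) : tHH (hbas e) (hbas e) xy = (xy == (e, e))%:R.
  case: xy => x' y'; rewrite !ffunE /= xpair_eqE.
  by rewrite -natrM mulnb ![_ == x']eq_sym ![_ == y']eq_sym.
rewrite /mulHH exchange_big (bigD1 (e, e)) //= [X in _ + X]big1 ?addr0 => [|x nx].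
  apply/ffunP => y; rewrite sum_ffunE (bigD1 y) //= big1 => [|x nx].
    rewrite E eqxx mulr1 muln0 expr0 mulr1.
    have e1 : hbas e = 1 by rewrite hbas_hg_hx /= expr0 mulr1 hg1.
    by rewrite !ffunE e1 !mulr1 !ffunE !eqxx !mulr1 addr0 /GRing.scale /= mulr1.
  have e1 : hbas e = 1 by rewrite hbas_hg_hx /= expr0 mulr1 hg1.
  case: y nx => y1 y2; case: x => x1 x2 nx; rewrite e1 !mulr1 !ffunE /=.
  by rewrite -natrM mulnb -xpair_eqE (negPf nx) scaler0.
by apply: big1 => y _; rewrite E (negPf nx) mulr0 mul0r scale0r.
Qed.

Lemma comul_hbas (a : I) :
  comul (hbas a) = mulHH (tHH (hg D a.1) (hg D a.1))
    (iter a.2 (mulHH^~ (tHH 1 (hx D) + tHH (hx D) (hg D (zc D))))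
         (tHH 1 1)).
Proof.
rewrite /comul (bigD1 a) //= big1 => [|b nb].
  by rewrite ffunE eqxx scale1r addr0.
by rewrite ffunE eq_sym (negPf nb) scale0r.
Qed.

Lemma comul_hg g : comul (hg D g) = tHH (hg D g) (hg D g).
Proof.
have -> : hg D g = hbas (g, Ordinal (ord_gt0 D)) :> H.
  by rewrite hbas_hg_hx /= expr0 mulr1.
by rewrite comul_hbas /= mulHHt1 hbas_hg_hx /= expr0 mulr1.
Qed.

Lemma comul_hx :
  comul (hx D) = tHH 1 (hx D) + tHH (hx D) (hg D (zc D)).
Proof.
rewrite [in LHS](_ : hx D = hbas (1%g, Ordinal (ord_gt1 D))).
  by rewrite comul_hbas /= hg1 !mulHH1t.
by rewrite hbas_hg_hx /= expr1 hg1 mul1r.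
Qed.

Lemma tens_univ (V W : lmodType k) (f : V -> H -> W) :
    (forall v, linear (f v)) -> (forall h, linear (f^~ h)) ->
  exists F : {linear {ffun I -> V} -> W},
    (forall v h, F (tVH v h) = f v h) /\
    (forall F' : {linear {ffun I -> V} -> W},
       (forall v h, F' (tVH v h) = f v h) -> F' =1 F).
Proof.
move=> f_lin1 f_lin2.
pose F (t : {ffun I -> V}) := \sum_a f (t a) (hbas a).
have F_lin : linear F.
  move=> c t u; rewrite /F scaler_sumr -big_split; apply: eq_bigr => a _ /=.
  by rewrite !ffunE f_lin2.
pose HF := GRing.isLinear.Build _ _ _ _ F F_lin.
pose FL : {linear {ffun I -> V} -> W} := HB.pack F HF.
have tsum (t : {ffun I -> V}) : t = \sum_a tVH (t a) (hbas a).
  apply/ffunP => b; rewrite sum_ffunE (bigD1 b) //= big1 => [|a nab].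
    by rewrite !ffunE eqxx scale1r addr0.
  by rewrite !ffunE (negPf nab) scale0r.
have F_pure v h : F (tVH v h) = f v h.
  pose fvL : {linear H -> W} :=
    HB.pack (f v) (GRing.isLinear.Build _ _ _ _ (f v) (f_lin1 v)).
  rewrite -[f v h]/(fvL h) [in RHS](hbas_sum h) linear_sum.
  apply: eq_bigr => a _; rewrite linearZ /= ffunE.
  pose faL : {linear V -> W} := HB.pack (f^~ (hbas a))
    (GRing.isLinear.Build _ _ _ _ (f^~ (hbas a)) (f_lin2 (hbas a))).
  by rewrite -[LHS]/(faL _) linearZ.
exists FL; split=> // F' F'E t; rewrite (tsum t) !linear_sum.
by apply: eq_bigr => a _; rewrite F'E -[RHS]/(F _) F_pure.
Qed.
End Tensor.

Section Comodule.
Variables (k : fieldType) (gT : finGroupType) (D : datum k gT).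
Variable B : algType k.

Local Notation I := (idx D).
Local Notation I2 := (idx D * idx D)%type.
Local Notation H := (HD D).
Local Notation HH := {ffun I2 -> k^o}.

Variable s : {linear {ffun I -> B} -> {ffun I -> B}}.
Variable nu : {linear B -> {ffun I -> B}}.

(* (mu_B (x) H)(B (x) s) on t (x) b', for t in B (x) H *)
Definition muB_s (t : {ffun I -> B}) (b' : B) : {ffun I -> B} :=
  [ffun i => \sum_a t a * s (tHV (hbas a) b') i].

Record left_transposition : Prop := LeftTransposition {
  lt_bij : bijective s;
  lt_one : forall b : B, s (tHV 1 b) = tVH b 1;
  lt_mul : forall t : {ffun I2 -> B},
    s (ampl (@mulH _ _ D) t) = ampl (@mulH _ _ D) (s_H s (H_s s t));
  lt_counit : forall t : {ffun I -> B}, id_counit (s t) = id_counit t;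
  lt_comul : forall t : {ffun I -> B},
    ampl (@comul _ _ D) (s t) = s_H s (H_s s (ampl (@comul _ _ D) t));
  lt_braid : forall t : {ffun I2 -> B},
    s_H s (H_s s (ampl (@braidH _ _ D) t)) =
    ampl (@braidH _ _ D) (s_H s (H_s s t));
  lt_oneB : forall h : H, s (tHV h 1) = tVH 1 h;
  lt_mulB : forall (h : H) (b b' : B),
    s (tHV h (b * b')) = muB_s (s (tHV h b)) b'
}.

(* (mu_B (x) H (x) H)(B (x) s (x) H) on t (x) u, for t, u in B (x) H *)
Definition muB_s_H (t u : {ffun I -> B}) : {ffun I2 -> B} :=
  [ffun ij => muB_s t (u ij.2) ij.1].

Record comodule_algebra : Prop := ComoduleAlgebra {
  ca_coassoc : forall b, nu_H nu (nu b) = ampl (@comul _ _ D) (nu b);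
  ca_counit : forall b, id_counit (nu b) = b;
  ca_transp : left_transposition;
  ca_nu_s : forall t : {ffun I -> B},
    nu_H nu (s t) = ampl (@braidH _ _ D) (s_H s (H_nu nu t));
  ca_nu_mul : forall b b' : B,
    nu (b * b') = ampl (@mulH _ _ D) (muB_s_H (nu b) (nu b'));
  ca_nu_one : nu 1 = tVH 1 1
}.

Definition i0 : 'I_(ord D) := Ordinal (ord_gt0 D).
Definition i1 : 'I_(ord D) := Ordinal (ord_gt1 D).

(* nu(b) = \sum_(g, i) U^g_i(b) (x) g x^i *)
Definition Ugi (g : gT) (i : 'I_(ord D)) (b : B) : B := nu b (g, i).
Definition Umap (b : B) : B := \sum_g Ugi g i1 b.

(* s(x (x) b) = alpha(b) (x) x: alpha(b) is the coefficient of x *)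
Definition alpha (b : B) : B := s (tHV (hx D) b) (1%g, i1).

(* membership in B_(g, zeta) *)
Definition Bgz (g : gT) (zeta : gT -> gT) (b : B) : Prop :=
  (exists b' : B, b = Ugi g i0 b') /\
  (forall h : gT, s (tHV (hg D h) b) = tVH b (hg D (zeta h))).

(* mu_B (f (x) f') Delta *)
Definition conv (f f' : H -> B) (h : H) : B :=
  \sum_(ab : I2) comul h ab *: (f (hbas ab.1) * f' (hbas ab.2)).

Definition conv_inverse (f f' : H -> B) : Prop :=
  (forall h, conv f f' h = counit h *: 1) /\
  (forall h, conv f' f h = counit h *: 1).

Record cleft_map (ga : {linear H -> B}) : Prop := CleftMap {
  cm_colinear : forall h : H, nu (ga h) = ga_H ga (comul h);
  cm_conv : exists ga' : {linear H -> B}, conv_inverse ga ga';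
  cm_braid : forall t : HH, ga_H ga (braidH t) = s (H_ga ga t)
}.

(* B need not be a unitRingType *)
Definition inverse_of (b b' : B) : Prop := b * b' = 1 /\ b' * b = 1.
Definition unitB (b : B) : Prop := exists b', inverse_of b b'.

Record cleft_family (bx : B) (b : gT -> B) : Prop := CleftFamily {
  cf_unit : forall g, unitB (b g);
  cf_bg : forall g, Bgz g id (b g) /\ Umap (b g) = 0;
  cf_bx : Bgz (zc D) id bx /\ Umap bx = 1;
  cf_alpha_bx : alpha bx = qq D *: bx;
  cf_alpha_bg : forall g, alpha (b g) = b g
}.

(* the linear map with value f g i at g x^i *)
Definition linext (f : gT -> nat -> B) (h : H) : B :=
  \sum_a (h : {ffun I -> k^o}) a *: f a.1 a.2.
Fact linext_is_linear f : linear (linext f).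
Proof.
move=> c u v; rewrite /linext scaler_sumr -big_split; apply: eq_bigr => a _ /=.
by rewrite !ffunE scalerDl scalerA.
Qed.
HB.instance Definition _ f :=
  GRing.isLinear.Build k H B *:%R (linext f) (linext_is_linear f).

Lemma linextE f g i : (i < ord D)%N -> linext f (hg D g * hx D ^+ i) = f g i.
Proof.
move=> lt_i; rewrite hg_hxX -[i]/(nat_of_ord (Ordinal lt_i)) nform_small.
rewrite /linext (bigD1 (g, Ordinal lt_i)) //= big1 => [|a na].
  by rewrite ffunE eqxx scale1r addr0.
by rewrite ffunE eq_sym (negPf na) scale0r.
Qed.

(* (B with coinvariants C, s) is cleft *)
Definition cleft : Prop := exists ga : {linear H -> B}, cleft_map ga.

End Comodule.

(* Main.v *)
From HB Require Import structures.
Require Import Defs.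
From mathcomp Require Import all_boot all_fingroup all_algebra.
From mathcomp Require Import ring.

Import GRing.Theory.
Local Open Scope ring_scope.

(** By the q-binomial theorem [Delta (g x^i)] is the sum over [j] of
    [binom(i, j)_(qp) g x^j (x) g z^j x^(i-j)].  Comparing coefficients in the
    coassociativity of [nu] gives [nu b_g = b_g (x) g] and
    [nu b_x = 1 (x) x + b_x (x) z].  If [b] commutes past [G] under [s], then
    [s (x (x) b)] is skew primitive in its [H_D]-leg, so it is
    [alpha b (x) x + beta (x) (1 - z)]; when also [alpha b = c b] with
    [c <> 0], the term [beta] vanishes because [(p, q) <> (1, -1)].  Hence [nu]
    and [s] are explicit on the products [b_g b_x^i]; colinearity and the braid
    condition follow, and the convolution inverse reduces to the vanishing of
    the alternating sums of q-binomials.  Conversely, [b_g = gamma(g)] and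
    [b_x = gamma(1)^-1 gamma(x)] work. *)

Set Implicit Arguments.
Unset Strict Implicit.

(** * Gaussian binomial coefficients and their alternating sums *)

Section QBinomial.
Variables (k : fieldType) (t : k).

(** The Gaussian binomial at [t]. The Pascal recursion avoids quotients of q-factorials, which may
    vanish when [t] is a root of unity. *)
Fixpoint qbin (m j : nat) : k :=
  match m, j with
  | _, 0 => 1
  | 0, _.+1 => 0
  | m'.+1, j'.+1 => qbin m' j' + t ^+ j'.+1 * qbin m' j'.+1
  end.

Arguments qbin : simpl never.

Lemma qbin0 m : qbin m 0 = 1. Proof. by case: m. Qed.

Lemma qbinS m j : qbin m.+1 j.+1 = qbin m j + t ^+ j.+1 * qbin m j.+1.
Proof. by []. Qed.

Lemma qbin_small m j : (m < j)%N -> qbin m j = 0.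
Proof.
elim: m j => [|m IH] [|j] //; rewrite ltnS => ltmj.
by rewrite qbinS !IH ?mulr0 ?addr0 // ltnW.
Qed.

Lemma qbinnn m : qbin m m = 1.
Proof. by elim: m => // m IH; rewrite qbinS IH qbin_small ?mulr0 ?addr0. Qed.

(** The quotient of neighbouring Gaussian binomials with denominators cleared; induction on [m],
    expanding by the Pascal rule. It yields the mirrored Pascal rule and the non-vanishing of
    [qbin m.+1 m]. *)
Lemma qbin_ratio m j : (j <= m)%N ->
  (1 - t ^+ j.+1) * qbin m j.+1 = (1 - t ^+ (m - j)) * qbin m j.
Proof.
elim: m j => [|m IH] [|j] // lejm.
- by rewrite subnn expr0 subrr mulr0 mul0r.
- have := IH 0 (leq0n m); rewrite qbinS !qbin0 !subn0 !mulr1 expr1 => E.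
  by rewrite mulrDr mulrCA E exprS; ring.
have [lejm'|gtjm] := ltnP j m; last first.
  have <- : j = m by apply/eqP; rewrite eqn_leq gtjm -ltnS lejm.
  by rewrite subnn expr0 subrr mul0r qbin_small ?mulr0.
rewrite subSS [qbin m.+1 j.+2]qbinS mulrDr mulrCA (IH j.+1) //.
rewrite [qbin m.+1 j.+1]qbinS mulrDr -(IH j) ?(ltnW lejm') //.
have -> : t ^+ (m - j) = t * t ^+ (m - j.+1) by rewrite -exprS subnSK.
by rewrite [t ^+ j.+2]exprS; ring.
Qed.

(** The Pascal rule with the power of [t] on the other summand; [qbin_ratio] says exactly that the
    two expansions agree. *)
Lemma qbinSr m j : (j <= m)%N ->
  qbin m.+1 j.+1 = qbin m j.+1 + t ^+ (m - j) * qbin m j.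
Proof.
move=> lejm; rewrite qbinS; have := qbin_ratio lejm.
rewrite !mulrBl !mul1r => E.
by rewrite -[t ^+ j.+1 * _](subKr (qbin m j.+1)) E; ring.
Qed.

(** By [qbin_ratio], [1 - t] times [qbin m.+1 m] is [1 - t ^+ m.+1]. This coefficient is cancelled
    when [Delta] is compared in degrees [m] and [1]. *)
Lemma qbin_pred_neq0 m : t ^+ m.+1 != 1 -> qbin m.+1 m != 0.
Proof.
move=> tm1; have := qbin_ratio (leqnSn m).
rewrite qbinnn mulr1 subSnn expr1 => E; apply/eqP => C0; move: E.
by rewrite C0 mulr0 => /eqP; rewrite subr_eq0 eq_sym (negPf tm1).
Qed.

(** The coefficient of the convolution inverse in degree [i]. The truncated [i - 1] is harmless at
    [i = 0], where the product is [0]. *)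
Definition qsgn (i : nat) : k := (-1) ^+ i * t ^+ ((i * (i - 1)) %/ 2)%N.

Lemma qsgnS i : qsgn i.+1 = - (t ^+ i * qsgn i).
Proof.
rewrite /qsgn exprS subn1 /=.
have -> : ((i.+1 * i) %/ 2 = i + (i * (i - 1)) %/ 2)%N.
  case: i => // i; rewrite subn1 /=.
  have -> : (i.+2 * i.+1 = i.+1 * 2 + i.+1 * i)%N.
    by rewrite -mulnDr addnC -addn2 mulnC.
  by rewrite divnMDl.
by rewrite exprD; ring.
Qed.

Lemma qbin_alt m : \sum_(j < m.+1) qbin m j * qsgn j = (m == 0%N)%:R.
Proof.
case: m => [|m]; first by rewrite big_ord1 /qsgn !expr0 !mulr1.
(* A closed form for the partial sums; at [N = m.+1] it has the factor [qbin m m.+1 = 0]. *)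
have part N : \sum_(j < N.+1) qbin m.+1 j * qsgn j = t ^+ N * qbin m N * qsgn N.
  elim: N => [|N IH]; first by rewrite big_ord1 /= !qbin0 expr0 !mul1r.
  by rewrite big_ord_recr /= qbinS IH qsgnS exprS; ring.
by rewrite part qbin_small // mulr0 mul0r.
Qed.

(** Needed next to [qbin_alt] because the other one-sided convolution product attaches the sign to
    [m - j]. *)
Lemma qbin_altr m : \sum_(j < m.+1) qbin m j * qsgn (m - j) = (m == 0%N)%:R.
Proof.
case: m => [|m]; first by rewrite big_ord1 /qsgn !expr0 !mulr1.
(* Partial sums in closed form for [N <= m]; at [N = m] the value is [-1], which cancels the last
   term of the full sum. *)
have part N : (N <= m)%N -> \sum_(j < N.+1) qbin m.+1 j * qsgn (m.+1 - j) =
    - (t ^+ (m - N) * qbin m N * qsgn (m - N)).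
  elim: N => [|N IH] leN.
    by rewrite big_ord1 /= !subn0 qsgnS !qbin0; ring.
  rewrite big_ord_recr IH ?(ltnW leN) //= subSS. rewrite qbinSr ?(ltnW leN) //.
  by rewrite -(subnSK leN) qsgnS; ring.
rewrite big_ord_recr part //= !subnn. rewrite !qbinnn expr0; ring.
Qed.

(** The inductive step of the q-binomial theorem, for an arbitrary sequence [F] in a module, so that
    it serves both [Delta (g x^i)] and [nu (b_g b_x^i)]. *)
Lemma qbin_sumS (V : lmodType k) (F : nat -> V) m :
  \sum_(j < m.+2) qbin m.+1 j *: F j =
  \sum_(j < m.+1) qbin m j *: (F j + t ^+ (m - j) *: F j.+1).
Proof.
under [RHS]eq_bigr => j _ do rewrite scalerDr scalerA.
rewrite big_split /= [LHS]big_ord_recl [X in _ = X + _]big_ord_recl -addrA /=.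
rewrite !qbin0; congr (_ + _).
have E (j : 'I_m.+1) : qbin m.+1 (lift ord0 j) *: F (lift ord0 j) =
    qbin m j.+1 *: F j.+1 + (qbin m j * t ^+ (m - j)) *: F j.+1.
  have lej : (j <= m)%N by rewrite -ltnS.
  by rewrite lift0 (qbinSr lej) scalerDl [t ^+ _ * _]mulrC.
under eq_bigr => j _ do rewrite E.
rewrite big_split /=; congr (_ + _).
by rewrite big_ord_recr /= qbin_small // scale0r addr0.
Qed.

End QBinomial.

Arguments qbin {k} t m j : simpl never.

(** * Product and comultiplication of [H_D] in coordinates *)

Section Tensors.
Variables (k : fieldType) (gT : finGroupType) (D : datum k gT).

Local Notation I := (idx D).
Local Notation I2 := (idx D * idx D)%type.
Local Notation H := (HD D).
Local Notation HH := {ffun I2 -> k^o}.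
Local Notation ev h := (h : {ffun I -> k^o}).
Local Notation n := (ord D).
Local Notation z := (zc D).
Local Notation q := (qq D).
Local Notation t := (qq D * chi D (zc D)).

Lemma hbas_coef (a b : I) : ev (hbas a) b = (a == b)%:R.
Proof. by rewrite ffunE. Qed.

Lemma nform_coef g m (b : I) : (m < n)%N ->
  ev (nform D g m) b = ((g == b.1) && (m == b.2 :> nat))%:R.
Proof.
move=> ltm; rewrite -[m]/(nat_of_ord (Ordinal ltm)) nform_small hbas_coef.
by case: b => h j; rewrite xpair_eqE.
Qed.

Lemma hg_coef g (b : I) : ev (hg D g) b = ((g == b.1) && (b.2 == 0%N :> nat))%:R.
Proof. by rewrite [LHS]nform_coef ?ord_gt0 // [0%N == _]eq_sym. Qed.

Lemma hx_coef (b : I) : ev (hx D) b = ((b.1 == 1%g) && (b.2 == 1%N :> nat))%:R.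
Proof. by rewrite [LHS]nform_coef ?ord_gt1 // [1%g == _]eq_sym [1%N == _]eq_sym. Qed.

Lemma h1_coef (b : I) : ev (1 : H) b = ((b.1 == 1%g) && (b.2 == 0%N :> nat))%:R.
Proof. by rewrite -hg1 hg_coef eq_sym. Qed.

Lemma tHH_sum (u : HH) : u = \sum_ab u ab *: tHH (hbas ab.1) (hbas ab.2).
Proof.
apply/ffunP => b; rewrite sum_ffunE (bigD1 b) //= big1 => [|a nab].
  by rewrite !ffunE !eqxx mul1r addr0 /GRing.scale /= mulr1.
rewrite !ffunE -natrM mulnb -xpair_eqE.
by case: a b nab => a1 a2 [b1 b2] nab; rewrite (negPf nab) scaler0.
Qed.

Lemma mulHH_sumZl (J : Type) (r : seq J) (c : J -> k) (f : J -> HH) (u : HH) :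
  mulHH (\sum_(j <- r) c j *: f j) u = \sum_(j <- r) c j *: mulHH (f j) u.
Proof.
have lin : linear (fun v : HH => mulHH v u).
  move=> d v w; rewrite /mulHH scaler_sumr -big_split; apply: eq_bigr => ab _ /=.
  rewrite scaler_sumr -big_split; apply: eq_bigr => cd _ /=.
  by rewrite !ffunE scalerA -scalerDl; congr (_ *: _); rewrite /GRing.scale /=; ring.
pose F : {linear HH -> HH} := HB.pack (fun v : HH => mulHH v u)
  (GRing.isLinear.Build _ _ _ _ _ lin).
by rewrite -[LHS]/(F _) linear_sum; apply: eq_bigr => j _; rewrite linearZ.
Qed.

Lemma mulHH_linear_r (u : HH) : linear (fun v : HH => mulHH u v).
Proof.
move=> d v w; rewrite /mulHH scaler_sumr -big_split; apply: eq_bigr => ab _ /=.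
rewrite scaler_sumr -big_split; apply: eq_bigr => cd _ /=.
by rewrite !ffunE scalerA -scalerDl; congr (_ *: _); rewrite /GRing.scale /=; ring.
Qed.

Lemma mulHHDr (u v w : HH) : mulHH u (v + w) = mulHH u v + mulHH u w.
Proof. by have := mulHH_linear_r u 1 v w; rewrite !scale1r. Qed.

Lemma mulHH_sumZr (J : Type) (r : seq J) (c : J -> k) (f : J -> HH) (u : HH) :
  mulHH u (\sum_(j <- r) c j *: f j) = \sum_(j <- r) c j *: mulHH u (f j).
Proof.
pose F : {linear HH -> HH} := HB.pack (fun v : HH => mulHH u v)
  (GRing.isLinear.Build _ _ _ _ _ (mulHH_linear_r u)).
by rewrite -[LHS]/(F _) linear_sum; apply: eq_bigr => j _; rewrite linearZ.
Qed.

Lemma tHHZl c (u w : H) : tHH (c *: u) w = c *: tHH u w.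
Proof. by apply/ffunP => ab; rewrite !ffunE /GRing.scale /= mulrA. Qed.

Lemma tHHZr c (u w : H) : tHH u (c *: w) = c *: tHH u w.
Proof. by apply/ffunP => ab; rewrite !ffunE /GRing.scale /= mulrCA. Qed.

Lemma nform_hbas g i (lti : (i < n)%N) : nform D g i = hbas (g, Ordinal lti).
Proof. by rewrite -nform_small. Qed.

Lemma nformM g h i j :
  nform D g i * nform D h j = chi D h ^+ i *: nform D (g * h)%g (i + j).
Proof. exact: hmul_nform. Qed.

(** The bounds make all four factors basis elements; the exponents [a + c] and [b + d] may reach
    [n], and [nform] then stands for the reduced element. *)
Lemma mulHH_nform g h g' h' a b c d :
  (a < n)%N -> (b < n)%N -> (c < n)%N -> (d < n)%N ->
  mulHH (tHH (nform D g a) (nform D h b)) (tHH (nform D g' c) (nform D h' d)) =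
  (q ^+ (b * c) * chi D g' ^+ a * chi D h' ^+ b)
    *: tHH (nform D (g * g')%g (a + c)) (nform D (h * h')%g (b + d)).
Proof.
move=> lta ltb ltc ltd; rewrite (nform_hbas _ lta) (nform_hbas _ ltb).
rewrite (nform_hbas _ ltc) (nform_hbas _ ltd) mulHH_bas -!nform_hbas /=.
by rewrite !nformM tHHZl tHHZr !scalerA mulrA.
Qed.

(** The q-binomial theorem: [x z = chi(z) z x] and the braid contributes [q], so [(1 (x) x)(x (x) z)
    = t (x (x) z)(1 (x) x)]. *)
Lemma comul_nform g i : (i < n)%N -> comul (nform D g i) =
  \sum_(j < i.+1) qbin t i j *: tHH (nform D g j) (nform D (g * z ^+ j)%g (i - j)).
Proof.
move=> lti; rewrite (nform_hbas _ lti) comul_hbas /=.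
have It : forall m, (m <= i)%N ->
    iter m (fun u : HH => mulHH u (tHH 1 (hx D) + tHH (hx D) (hg D z))) (tHH 1 1)
    = \sum_(j < m.+1) qbin t m j *: tHH (nform D 1 j) (nform D (z ^+ j)%g (m - j)).
  elim=> [|m IH] lem; first by rewrite big_ord1 scale1r.
  have ltm : (m < n)%N by apply: leq_ltn_trans lti; apply: ltnW.
  rewrite iterS IH ?(ltnW lem) // mulHH_sumZl.
  (* Right multiplication by [Delta(x)]: the summand [1 (x) x] raises the second exponent, and
     [x (x) z], moved past [x^(m-j)], raises [j] with the factor [t ^+ (m - j)]. *)
  have step (j : 'I_m.+1) : mulHH (tHH (nform D 1 j) (nform D (z ^+ j)%g (m - j)))
      (tHH 1 (hx D) + tHH (hx D) (hg D z)) =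
      tHH (nform D 1 j) (nform D (z ^+ j)%g (m.+1 - j))
      + t ^+ (m - j) *: tHH (nform D 1 j.+1) (nform D (z ^+ j.+1)%g (m.+1 - j.+1)).
    have lej : (j <= m)%N by rewrite -ltnS.
    have ltj : (j < n)%N by apply: leq_ltn_trans ltm.
    have ltmj : (m - j < n)%N by apply: leq_ltn_trans ltm; apply: leq_subr.
    rewrite mulHHDr -{1}hg1 !mulHH_nform ?ord_gt0 ?ord_gt1 //.
    rewrite !mulg1 !chi1 !expr1n muln0 muln1 !mulr1 expr0 scale1r -exprMn.
    by rewrite addn0 addn1 addn0 addn1 subSn // subSS expgSr.
  rewrite (qbin_sumS _ (fun j => tHH (nform D 1 j) (nform D (z ^+ j)%g (m.+1 - j)))).
  by apply: eq_bigr => j _; rewrite step.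
rewrite It // mulHH_sumZr; apply: eq_bigr => j _; congr (_ *: _).
have lej : (j <= i)%N by rewrite -ltnS.
have ltj : (j < n)%N by apply: leq_ltn_trans lti.
have ltmj : (i - j < n)%N by apply: leq_ltn_trans lti; apply: leq_subr.
by rewrite mulHH_nform ?ord_gt0 // !expr0 !mulr1 scale1r mulg1.
Qed.

(** A basis tensor [(b, c)] occurs in [Delta] of at most one basis element, of exponent [b.2 + c.2].
    Comparing coefficients under [Delta] therefore gives equations with a single term. *)
Lemma comul_coef (a b c : I) : comul (hbas a) (b, c) =
  qbin t a.2 b.2
    *+ [&& a.1 == b.1, c.1 == (b.1 * z ^+ b.2)%g & a.2 == (b.2 + c.2)%N :> nat].
Proof.
have -> : hbas a = nform D a.1 a.2 by case: a => g i; rewrite nform_small.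
rewrite comul_nform // sum_ffunE.
have [ltab|leba] := ltnP a.2 b.2.
  have -> : (a.2 == (b.2 + c.2)%N :> nat) = false.
    by apply: contraTF ltab => /eqP ->; rewrite -leqNgt leq_addr.
  rewrite !andbF; apply: big1 => j _.
  have ltj : (j < n)%N by apply: leq_ltn_trans (ltn_ord a.2); rewrite -ltnS.
  rewrite !ffunE nform_coef //=; have [jb|_] := eqVneq (j : nat) b.2.
    by move: (ltn_ord j); rewrite jb ltnS leqNgt ltab.
  by rewrite andbF mul0r scaler0.
rewrite (bigD1 (Ordinal (leba : b.2 < a.2.+1)%N)) //= big1 ?addr0 => [|j nj].
  rewrite !ffunE /= nform_coef // nform_coef ?eqxx ?andbT; last first.
    by apply: leq_ltn_trans (ltn_ord a.2); apply: leq_subr.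
  rewrite -natrM mulnb /GRing.scale /= mulr_natr; congr (_ *+ nat_of_bool _).
  case: eqP => //= ->; rewrite [_ == c.1]eq_sym; congr (_ && _).
  by rewrite -(eqn_add2l b.2) subnKC.
have ltj : (j < n)%N by apply: leq_ltn_trans (ltn_ord a.2); rewrite -ltnS.
rewrite !ffunE nform_coef //=; have [jb|_] := eqVneq (j : nat) b.2.
  by case/eqP: nj; apply: val_inj.
by rewrite andbF mul0r scaler0.
Qed.

Lemma braidH_tHH (a b : I) :
  braidH (tHH (hbas a) (hbas b)) = q ^+ (a.2 * b.2) *: tHH (hbas b) (hbas a).
Proof.
rewrite /braidH (bigD1 (a, b)) //= big1 ?addr0 => [|c nc].
  by rewrite !ffunE !eqxx !mulr1.
rewrite ffunE !hbas_coef -natrM mulnb -xpair_eqE -surjective_pairing [_ == c]eq_sym.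
by case: c nc => c d /negPf ncd; rewrite ncd mulr0 scale0r.
Qed.

End Tensors.

(** * Maps on the [H_D]-legs of tensors with coefficients in [V] *)

Section Amplification.
Variables (k : fieldType) (gT : finGroupType) (D : datum k gT).
Variable V : lmodType k.

Local Notation I := (idx D).
Local Notation I2 := (idx D * idx D)%type.
Local Notation H := (HD D).
Local Notation ev h := (h : {ffun I -> k^o}).
Local Notation n := (ord D).
Local Notation z := (zc D).
Local Notation q := (qq D).
Local Notation t := (qq D * chi D (zc D)).

(** The ordinal [i] records that [b.2 + c.2 < n]; by [comul_coef] the sum over the basis then has at
    most one nonzero term. *)
Lemma ampl_comul (v : {ffun I -> V}) (b c : I) (i : 'I_n) :
  i = (b.2 + c.2)%N :> nat ->
  ampl (@comul _ _ D) v (b, c) =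
  (qbin t i b.2 *: v (b.1, i)) *+ (c.1 == b.1 * z ^+ b.2)%g.
Proof.
move=> ei; rewrite ffunE (bigD1 (b.1, i)) //= big1 ?addr0 => [|a na].
  rewrite [comul _ _](comul_coef (b.1, i)) /= eqxx ei eqxx andbT /=.
  by rewrite scalerMnl.
rewrite [comul _ _]comul_coef; case: eqP => [a1|_]; last by rewrite scale0r.
case: eqP => _; last by rewrite scale0r.
case: eqP => [a2|_]; last by rewrite scale0r.
case/eqP: na; case: a a1 a2 => a1 a2 /= -> ea2; congr (_, _).
by apply: val_inj; rewrite /= ea2 ei.
Qed.

Lemma ampl_mulH (v : {ffun I2 -> V}) :
  ampl (@mulH _ _ D) v = \sum_a \sum_b tHV (hbas a * hbas b) (v (a, b)).
Proof.
rewrite pair_bigA; apply/ffunP => y; rewrite sum_ffunE ffunE.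
apply: eq_bigr => -[x1 x2] _; set x := (x1, x2); rewrite ffunE; congr (_ *: _).
rewrite /mulH sum_ffunE (bigD1 x) //= big1 => [|a na].
  by rewrite !ffunE eqxx addr0 /GRing.scale /= mul1r.
by rewrite !ffunE eq_sym (negPf na) /GRing.scale /= mul0r.
Qed.

Lemma ampl_braidH (v : {ffun I2 -> V}) (x y : I) :
  ampl (@braidH _ _ D) v (x, y) = q ^+ (x.2 * y.2) *: v (y, x).
Proof.
have E (a : I2) : braidH (dlt k a) (x, y) = q ^+ (x.2 * y.2) *+ (a == (y, x)).
  rewrite /braidH sum_ffunE (bigD1 a) //= big1 => [|b nb].
    rewrite !ffunE eqxx mulr1 addr0 -natrM mulnb -xpair_eqE /GRing.scale /=.
    rewrite mulr_natr; case: a => a1 a2; rewrite !xpair_eqE andbC.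
    by case: eqP => //= ->; case: eqP => //= ->; rewrite mulnC.
  by rewrite !ffunE eq_sym (negPf nb) mulr0 scale0r.
rewrite ffunE (bigD1 (y, x)) //= big1 ?addr0 => [|a na]; rewrite E ?eqxx //.
by rewrite (negPf na) scale0r.
Qed.

Lemma ampl_morphD (J K : finType) (f : {ffun J -> k^o} -> {ffun K -> k^o})
  (u v : {ffun J -> V}) : ampl f (u + v) = ampl f u + ampl f v.
Proof.
apply/ffunP => y; rewrite !ffunE -big_split; apply: eq_bigr => x _ /=.
by rewrite ffunE scalerDr.
Qed.

Lemma tHVZ c (w : H) (v : V) : tHV (c *: w) v = c *: tHV w v.
Proof. by apply/ffunP => a; rewrite !ffunE scalerA. Qed.
Lemma tHVZr c (w : H) (v : V) : tHV w (c *: v) = c *: tHV w v.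
Proof. by apply/ffunP => a; rewrite !ffunE !scalerA mulrC. Qed.

Lemma tHV_sum (w : H) (v : V) : tHV w v = \sum_a tHV (hbas a) (ev w a *: v).
Proof.
apply/ffunP => b; rewrite sum_ffunE ffunE (bigD1 b) //= big1 => [|a na].
  by rewrite ffunE hbas_coef eqxx scale1r addr0.
by rewrite ffunE hbas_coef (negPf na) scale0r.
Qed.

Lemma ffun_tHV_sum (v : {ffun I -> V}) : v = \sum_a tHV (hbas a) (v a).
Proof.
apply/ffunP => b; rewrite sum_ffunE (bigD1 b) //= big1 => [|a na].
  by rewrite ffunE hbas_coef eqxx scale1r addr0.
by rewrite ffunE hbas_coef (negPf na) scale0r.
Qed.

(* [u (x) w (x) v], with the two legs in [H_D] first *)
Definition tHHV (u w : H) (v : V) : {ffun I2 -> V} :=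
  [ffun xy => (ev u xy.1 * ev w xy.2) *: v].

Lemma ampl_mulH_r (w : H) (v : {ffun I -> V}) :
  ampl (@mulH _ _ D) [ffun xy : I2 => ev w xy.2 *: v xy.1] =
  \sum_a tHV (hbas a * w) (v a).
Proof.
rewrite ampl_mulH /=.
apply: eq_bigr => a _; rewrite {2}(hbas_sum w) mulr_sumr.
apply/ffunP => y; rewrite sum_ffunE ffunE sum_ffunE scaler_suml.
by apply: eq_bigr => b _; rewrite !ffunE -scalerAr ffunE scalerA mulrC.
Qed.

Lemma ampl_mulH_l (w : H) (v : {ffun I -> V}) :
  ampl (@mulH _ _ D) [ffun xy : I2 => ev w xy.1 *: v xy.2] =
  \sum_a tHV (w * hbas a) (v a).
Proof.
rewrite ampl_mulH exchange_big /=.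
apply: eq_bigr => a _; rewrite {2}(hbas_sum w) mulr_suml.
apply/ffunP => y; rewrite sum_ffunE ffunE sum_ffunE scaler_suml.
by apply: eq_bigr => b _; rewrite !ffunE -scalerAl ffunE scalerA mulrC.
Qed.

Lemma ampl_mulH_pure (u w : H) (v : V) :
  ampl (@mulH _ _ D) (tHHV u w v) = tHV (u * w) v.
Proof.
have -> : tHHV u w v = [ffun xy : I2 => ev w xy.2 *: tHV u v xy.1].
  by apply/ffunP => xy; rewrite !ffunE scalerA mulrC.
rewrite ampl_mulH_r {2}(hbas_sum u) mulr_suml.
apply/ffunP => y; rewrite sum_ffunE ffunE sum_ffunE scaler_suml.
by apply: eq_bigr => b _; rewrite !ffunE -scalerAl ffunE scalerA mulrC.
Qed.

Variable s : {linear {ffun I -> V} -> {ffun I -> V}}.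

Lemma H_s_pure u w v :
  H_s s (tHHV u w v) = [ffun xy : I2 => ev u xy.1 *: s (tHV w v) xy.2].
Proof.
apply/ffunP => -[x y]; rewrite !ffunE /=.
have -> : [ffun b => tHHV u w v (x, b)] = ev u x *: tHV w v.
  by apply/ffunP => b; rewrite !ffunE scalerA.
by rewrite linearZ ffunE.
Qed.

Lemma s_H_l (u : H) (v : {ffun I -> V}) :
  s_H s [ffun xy : I2 => ev u xy.1 *: v xy.2] =
  [ffun xy : I2 => s (tHV u (v xy.2)) xy.1].
Proof.
apply/ffunP => -[x y]; rewrite !ffunE /=; congr (s _ _).
by apply/ffunP => b; rewrite !ffunE.
Qed.

Lemma s_H_pure u w v :
  s_H s (tHHV u w v) = [ffun xy : I2 => ev w xy.2 *: s (tHV u v) xy.1].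
Proof.
apply/ffunP => -[x y]; rewrite !ffunE /=.
have -> : [ffun b => tHHV u w v (b, y)] = ev w y *: tHV u v.
  by apply/ffunP => b; rewrite !ffunE scalerA mulrC.
by rewrite linearZ ffunE.
Qed.

Lemma s_H_morphD v1 v2 : s_H s (v1 + v2) = s_H s v1 + s_H s v2.
Proof.
apply/ffunP => -[x y]; rewrite !ffunE /=.
have -> : [ffun a => (v1 + v2) (a, y)] = [ffun a => v1 (a, y)] + [ffun a => v2 (a, y)].
  by apply/ffunP => b; rewrite !ffunE.
by rewrite linearD ffunE.
Qed.

Lemma H_s_morphD v1 v2 : H_s s (v1 + v2) = H_s s v1 + H_s s v2.
Proof.
apply/ffunP => -[x y]; rewrite !ffunE /=.
have -> : [ffun a => (v1 + v2) (x, a)] = [ffun a => v1 (x, a)] + [ffun a => v2 (x, a)].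
  by apply/ffunP => b; rewrite !ffunE.
by rewrite linearD ffunE.
Qed.

Lemma s_HZ c v : s_H s (c *: v) = c *: s_H s v.
Proof.
apply/ffunP => -[x y]; rewrite !ffunE /=.
have -> : [ffun a => (c *: v) (a, y)] = c *: [ffun a => v (a, y)].
  by apply/ffunP => b; rewrite !ffunE.
by rewrite linearZ ffunE.
Qed.

Lemma H_sZ c v : H_s s (c *: v) = c *: H_s s v.
Proof.
apply/ffunP => -[x y]; rewrite !ffunE /=.
have -> : [ffun a => (c *: v) (x, a)] = c *: [ffun a => v (x, a)].
  by apply/ffunP => b; rewrite !ffunE.
by rewrite linearZ ffunE.
Qed.

(* [s (h (x) v) = v' (x) h] *)
Definition swaps (h : H) (v v' : V) := s (tHV h v) = tHV h v'.

Lemma sH_Hs_swaps u w v v' : swaps w v v' ->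
  s_H s (H_s s (tHHV u w v)) = [ffun xy : I2 => ev w xy.2 *: s (tHV u v') xy.1].
Proof.
move=> sw; rewrite H_s_pure sw -s_H_pure; congr (s_H s _).
by apply/ffunP => xy; rewrite !ffunE scalerA.
Qed.

Lemma swapsZ h v v' c : swaps h v v' -> swaps h (c *: v) (c *: v').
Proof. by rewrite /swaps => sw; rewrite !tHVZr linearZ sw. Qed.

End Amplification.

(** * Consequences of the axioms of a left transposition *)

Section Transposition.
Variables (k : fieldType) (gT : finGroupType) (D : datum k gT).
Variable B : algType k.

Local Notation I := (idx D).
Local Notation I2 := (idx D * idx D)%type.
Local Notation H := (HD D).
Local Notation ev h := (h : {ffun I -> k^o}).
Local Notation n := (ord D).
Local Notation z := (zc D).
Local Notation q := (qq D).
Local Notation p := (pp D).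
Local Notation t := (qq D * chi D (zc D)).
Local Notation i0 := (i0 D).
Local Notation i1 := (i1 D).

Lemma comul_sum (u : H) : comul u = \sum_a ev u a *: comul (hbas a).
Proof. by apply: eq_bigr => a _; rewrite comul_hbas. Qed.

Lemma ampl_comul_pure (u : H) (b : B) :
  ampl (@comul _ _ D) (tHV u b) = [ffun xy => comul u xy *: b].
Proof.
apply/ffunP => xy; rewrite !ffunE comul_sum sum_ffunE scaler_suml.
by apply: eq_bigr => a _; rewrite !ffunE scalerA mulrC.
Qed.

(** [t] has order exactly [n] and [0 < i < n], so [t ^+ i] is not [1]. *)
Lemma qbin_pred_idx_neq0 (i : 'I_n) m : i = m.+1 :> nat -> qbin t i m != 0.
Proof.
move=> ei; rewrite ei; apply: qbin_pred_neq0; apply/negP => /eqP t1.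
have := ltn_ord i; rewrite ei ltnNge; apply/negP/negPn.
have /prim_order_dvd := qp_prim D; move/(_ m.+1); rewrite t1 eqxx.
by move/dvdn_leq; apply.
Qed.

Variable s : {linear {ffun I -> B} -> {ffun I -> B}}.
Hypothesis hs : left_transposition s.

Lemma swaps_mulH u w b b1 b2 :
  swaps s w b b1 -> swaps s u b1 b2 -> swaps s (u * w) b b2.
Proof.
rewrite /swaps => sw su; rewrite -ampl_mulH_pure (lt_mul hs) (sH_Hs_swaps _ sw) su.
rewrite -ampl_mulH_pure; congr (ampl _ _); apply/ffunP => xy.
by rewrite !ffunE scalerA mulrC.
Qed.

Lemma muB_s_pure w b b' : muB_s s (tHV w b) b' = [ffun i => b * s (tHV w b') i].
Proof.
apply/ffunP => i; rewrite !ffunE (tHV_sum w b') linear_sum sum_ffunE mulr_sumr.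
by apply: eq_bigr => a _; rewrite ffunE tHVZr linearZ ffunE -scalerAl -scalerAr.
Qed.

Lemma swaps_mulB h b b1 b' b1' :
  swaps s h b b1 -> swaps s h b' b1' -> swaps s h (b * b') (b1 * b1').
Proof.
rewrite /swaps => sb sb'; rewrite (lt_mulB hs) sb muB_s_pure sb'.
by apply/ffunP => a; rewrite !ffunE scalerAr.
Qed.

Lemma swaps_oneB h : swaps s h 1 1.
Proof. by rewrite /swaps (lt_oneB hs). Qed.

(** By multiplicativity of [s], each factor [x] contributes [c] and the group element contributes no
    scalar. *)
Lemma swaps_nform g i b c : (forall g, swaps s (hg D g) b b) ->
  swaps s (hx D) b (c *: b) -> swaps s (nform D g i) b (c ^+ i *: b).
Proof.
move=> sg sx; elim: i => [|i IH]; first by rewrite expr0 scale1r; apply: sg.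
have -> : nform D g i.+1 = nform D g i * hx D.
  by rewrite [RHS]nformM chi1 expr1n scale1r mulg1 addn1.
by apply: swaps_mulH sx _; rewrite exprS -scalerA; apply: swapsZ.
Qed.

(** * The shape of [s (x (x) b)] for [b] commuting with [G] under [s] *)

Section Skew.
Variables (b : B) (c : k).
Hypothesis sg : forall g, swaps s (hg D g) b b.
Let Y := s (tHV (hx D) b).

(** The axiom on [Delta], with [Delta(x) = 1 (x) x + x (x) z] and [z] moved past [b] by [sg]: the
    [H_D]-leg of [Y] is skew primitive. The next lemmas read off coefficients. *)
Lemma s_hx_skew (x y : I) :
  ampl (@comul _ _ D) Y (x, y) = ev (1 : H) x *: Y y + ev (hg D z) y *: Y x.
Proof.
rewrite (lt_comul hs) ampl_comul_pure comul_hx.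
have -> : [ffun xy => (tHH 1 (hx D) + tHH (hx D) (hg D z)) xy *: b] =
    tHHV 1 (hx D) b + tHHV (hx D) (hg D z) b.
  by apply/ffunP => xy; rewrite !ffunE scalerDl.
rewrite H_s_morphD s_H_morphD (sH_Hs_swaps _ (sg z)) H_s_pure s_H_l !ffunE /=.
by rewrite (lt_one hs) ffunE.
Qed.

(** At the pair [h x^(i-1)], [h z^(i-1) x] both exponents are positive, so the right side of
    [s_hx_skew] vanishes, while the left side is a nonzero multiple of [Y (h, i)]. *)
Lemma s_hx_ge2 h (i : 'I_n) : (1 < i)%N -> Y (h, i) = 0.
Proof.
case ei: (i : nat) => [|[|m]] // _.
have ltm : (m.+1 < n)%N by apply: leq_trans (ltn_ord i); rewrite ei.
have := s_hx_skew (h, Ordinal ltm) ((h * z ^+ m.+1)%g, i1).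
rewrite (@ampl_comul _ _ _ _ _ _ _ i) /= ?addn1 // eqxx mulr1n h1_coef hg_coef /=.
rewrite !andbF !scale0r addr0 => /eqP; rewrite scaler_eq0.
by rewrite (negPf (qbin_pred_idx_neq0 ei)) => /eqP.
Qed.

Lemma s_hx_1 h : h != 1%g -> Y (h, i1) = 0.
Proof.
move=> nh; have := s_hx_skew (h, i0) (h, i1).
rewrite (@ampl_comul _ _ _ _ _ _ _ i1) //= mulg1 eqxx h1_coef hg_coef /=.
by rewrite (negPf nh) andbF !scale0r addr0 qbin0 scale1r.
Qed.

Lemma s_hx_0 h : h != 1%g -> h != z -> Y (h, i0) = 0.
Proof.
move=> nh nz; have := s_hx_skew (h, i0) (h, i0).
rewrite (@ampl_comul _ _ _ _ _ _ _ i0) //= mulg1 eqxx h1_coef hg_coef /=.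
by rewrite [z == h]eq_sym (negPf nh) (negPf nz) !scale0r addr0 qbin0 scale1r.
Qed.

Lemma s_hx_z : Y (z, i0) = - Y (1%g, i0).
Proof.
have := s_hx_skew (1%g, i0) (z, i0).
rewrite (@ampl_comul _ _ _ _ _ _ _ i0) //= mulg1 h1_coef hg_coef /= !eqxx qbin0.
(* If [z = 1] the comparison reads [Y = Y + Y] on the coefficient of [1], which is then [0];
   otherwise its left side vanishes. *)
rewrite !scale1r; case: eqP => [->|_]; last by move/esym/eqP; rewrite addr_eq0 => /eqP.
rewrite mulr1n => /esym/eqP; rewrite -subr_eq0 addrK => /eqP ->.
by rewrite oppr0.
Qed.

(** The braid axiom on [g (x) x (x) b]: [c] exchanges [g] and [x] without a power of [q], as [g] has
    degree [0]. So every coefficient of [Y] again commutes with [G] under [s]. *)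
Lemma s_hx_stable g x : swaps s (hg D g) (Y x) (Y x).
Proof.
apply/ffunP => y.
have := congr1 (fun v : {ffun I2 -> B} => v (x, y))
  (lt_braid hs (tHHV (hg D g) (hx D) b)).
rewrite ampl_braidH H_s_pure -/Y s_H_l [X in _ = X -> _]/=.
have -> : ampl (@braidH _ _ D) (tHHV (hg D g) (hx D) b) = tHHV (hx D) (hg D g) b.
  apply/ffunP => -[u v]; rewrite ampl_braidH !ffunE /= hg_coef hx_coef.
  case: (nat_of_ord v.2 =P 0%N) => [->|_]; last by
    rewrite andbF !mul0r mulr0 scale0r scaler0.
  by rewrite muln0 expr0 scale1r mulrC.
rewrite (sH_Hs_swaps _ (sg g)) -/Y !ffunE /= hg_coef.
case: (nat_of_ord y.2 =P 0%N) => [->|_].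
  by rewrite muln0 expr0 scale1r.
(* In positive degree the relation says that a power of [q] times the coefficient is [0], and [q] is
   invertible. *)
rewrite andbF scale0r => /esym/eqP; rewrite scaler_eq0.
by rewrite (negPf (expf_neq0 _ (qq_neq0 D))) => /eqP.
Qed.

(** Moving both sides of [x z = p z x] past [b] gives [Y z = p z Y]. The coefficient of [z] in [Y z]
    and in [z Y] is that of [1] in [Y]. *)
Lemma s_hx_chi : Y (1%g, i0) = p *: Y (1%g, i0).
Proof.
have Ezr (h : gT) : (h * z == z)%g = (h == 1%g).
  by rewrite -[X in _ == X]mul1g; apply: (inj_eq (mulIg z)).
have Ezl (h : gT) : (z * h == z)%g = (h == 1%g) by rewrite zc_central.
have E : tHV (hx D * hg D z) b = p *: tHV (hg D z * hx D) b.
  by rewrite hx_hg tHVZ.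
have := congr1 s E; rewrite linearZ /= -!ampl_mulH_pure !(lt_mul hs).
rewrite (sH_Hs_swaps _ (sg z)) ampl_mulH_r H_s_pure -/Y s_H_l.
have -> : [ffun xy : I2 => s (tHV (hg D z) (Y xy.2)) xy.1] =
    [ffun xy => ev (hg D z) xy.1 *: Y xy.2].
  by apply/ffunP => xy; rewrite !ffunE s_hx_stable ffunE.
rewrite ampl_mulH_l => /(congr1 (fun v : {ffun I -> B} => v (z, i0))).
rewrite [in X in _ = X -> _]ffunE !sum_ffunE (bigD1 (1%g, i0)) //= big1 => [|a na].
  rewrite (bigD1 (1%g, i0)) //= big1 => [|a na].
    rewrite !ffunE !hbasE !nformM /= !expr0 !scale1r mulg1 mul1g.
    by rewrite nform_coef ?ord_gt0 // !eqxx scale1r !addr0.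
  rewrite ffunE hbasE nformM expr0 scale1r add0n nform_coef //=.
  rewrite Ezl.
  by case: a na => a1 a2; rewrite xpair_eqE -val_eqE => /negPf -> /=; rewrite scale0r.
rewrite ffunE hbasE nformM addn0 ffunE nform_coef //=.
rewrite Ezr.
by case: a na => a1 a2; rewrite xpair_eqE -val_eqE => /negPf -> /=;
  rewrite scaler0 scale0r.
Qed.

Hypothesis alpha_b : alpha s b = c *: b.

(** The braid axiom on [x (x) x (x) b], where [c (x (x) x) = q x (x) x]: of the coefficients of [T]
    at [1 (x) x] and at [x (x) 1], each is [q] times the other. *)
Lemma s_hx_braid : c *: (q ^+ 2 *: Y (1%g, i0)) = c *: Y (1%g, i0).
Proof.
pose T := s_H s (H_s s (tHHV (hx D) (hx D) b)).
have TE x y : T (x, y) = s (tHV (hx D) (Y y)) x.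
  by rewrite /T H_s_pure s_H_l ffunE.
have brT x y : q *: T (x, y) = q ^+ (x.2 * y.2) *: T (y, x).
  have := congr1 (fun v : {ffun I2 -> B} => v (x, y))
    (lt_braid hs (tHHV (hx D) (hx D) b)).
  rewrite ampl_braidH -/T => <-.
  have -> : ampl (@braidH _ _ D) (tHHV (hx D) (hx D) b) = q *: tHHV (hx D) (hx D) b.
    apply/ffunP => -[u v]; rewrite ampl_braidH !ffunE /= !hx_coef.
    case: (nat_of_ord u.2 =P 1%N) => [->|_]; last by
      rewrite andbF mulr0 mul0r !scale0r !scaler0.
    case: (nat_of_ord v.2 =P 1%N) => [->|_]; last by
      rewrite andbF mulr0 mul0r !scale0r !scaler0.
    by rewrite mulrC.
  by rewrite H_sZ s_HZ [RHS]ffunE.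
(* The coefficient of [x] in [Y] is [alpha b = c b], so moving [x] past it reproduces [c] times
   [Y]. *)
have Te : T ((1%g, i0), (1%g, i1)) = c *: Y (1%g, i0).
  by rewrite TE -[Y (1%g, i1)]/(alpha s b) alpha_b tHVZr linearZ ffunE.
have := brT (1%g, i0) (1%g, i1); have := brT (1%g, i1) (1%g, i0).
rewrite /= muln0 mul0n !expr0 !scale1r Te => E1 E2; move: E1; rewrite -E2 !scalerA => <-.
by congr (_ *: _); ring.
Qed.

(* The term [beta (x) (1 - z)] is killed by [x z = p z x] if [p <> 1], and by
   the braid relation on [x (x) x (x) b] if [q ^+ 2 <> 1]. *)
Lemma swaps_hx : (p, q) <> (1, -1) -> c != 0 -> swaps s (hx D) b (c *: b).
Proof.
move=> hpq c0.
have Y10 : Y (1%g, i0) = 0.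
  have := s_hx_chi; have [p1 _|np1 /eqP] := eqVneq p 1; last first.
    rewrite -subr_eq0 -{1}[Y _]scale1r -scalerBl scaler_eq0 subr_eq0 eq_sym.
    by rewrite (negPf np1) => /eqP.
  (* Here [q = -1] is excluded by [hpq], and [q = 1] would give [qp = 1], against [n > 1]. *)
  have nq2 : q ^+ 2 != 1.
    rewrite sqrf_eq1; apply/norP; split; apply/eqP => q1; last first.
      by apply: hpq; rewrite p1 q1.
    have : (n %| 1)%N by rewrite (prim_order_dvd (qp_prim D)) expr1 -/p p1 q1 mul1r.
    by rewrite dvdn1 => /eqP n1; have := ord_gt1 D; rewrite n1.
  have /eqP := s_hx_braid; rewrite -subr_eq0 -scalerBr scaler_eq0 (negPf c0) /=.
  rewrite -{2}[Y _]scale1r -scalerBl scaler_eq0 subr_eq0 (negPf nq2) /=.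
  by move/eqP.
apply/ffunP => -[h i]; rewrite -/Y ffunE hx_coef /=.
case ei: (i : nat) => [|[|m]]; last by rewrite andbF scale0r s_hx_ge2 ?ei.
  have -> : i = i0 by apply: val_inj.
  rewrite andbF scale0r; have [->//|nh] := eqVneq h 1%g.
  have [->|nz] := eqVneq h z; first by rewrite s_hx_z Y10 oppr0.
  exact: s_hx_0.
have -> : i = i1 by apply: val_inj.
have [->|nh] := eqVneq h 1%g; last by rewrite scale0r s_hx_1.
by rewrite scale1r -alpha_b.
Qed.

End Skew.
End Transposition.

(** * The counit, convolution products and maps applied to one leg *)

Section Convolution.
Variables (k : fieldType) (gT : finGroupType) (D : datum k gT).
Variable B : algType k.

Local Notation I := (idx D).
Local Notation I2 := (idx D * idx D)%type.
Local Notation H := (HD D).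
Local Notation HH := {ffun I2 -> k^o}.
Local Notation ev h := (h : {ffun I -> k^o}).
Local Notation n := (ord D).
Local Notation z := (zc D).
Local Notation t := (qq D * chi D (zc D)).
Local Notation i0 := (i0 D).

Lemma counit_nform g i : (i < n)%N -> counit (nform D g i) = (i == 0%N)%:R.
Proof.
move=> lti; rewrite /counit.
have [->|ni] := eqVneq i 0%N.
  rewrite (bigD1 (g, i0)) //= big1 => [|a /andP[a0 na]].
    by rewrite nform_coef ?ord_gt0 // !eqxx addr0.
  rewrite nform_coef ?ord_gt0 //; case: eqP => // ga; case: eqP => // a2.
  by case/eqP: na; case: a {a0} ga a2 => a1 a2 /= -> ea; congr (_, _); apply: val_inj.
rewrite big1 // => a /eqP a0; rewrite nform_coef //.
by rewrite [nat_of_ord a.2]a0 (negPf ni) andbF.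
Qed.

Lemma counit_sum (u : H) : counit u = \sum_a (ev u a : k) * counit (hbas a).
Proof.
under [RHS]eq_bigr => a _ do rewrite hbasE counit_nform //.
rewrite /counit big_mkcond; apply: eq_bigr => a _ /=.
by case: eqP; rewrite ?mulr1 ?mulr0.
Qed.

Lemma linear_hbas (W : lmodType k) (F : {linear H -> W}) (u : H) :
  F u = \sum_a ev u a *: F (hbas a).
Proof.
rewrite [u in LHS]hbas_sum linear_sum; apply: eq_bigr => a _.
by rewrite linearZ.
Qed.

Variables f f' : {linear H -> B}.

Lemma conv_sum (u : H) : conv f f' u = \sum_a ev u a *: conv f f' (hbas a).
Proof.
rewrite /conv comul_sum; under [RHS]eq_bigr => a _ do rewrite scaler_sumr.
rewrite exchange_big /=; apply: eq_bigr => ab _.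
by rewrite sum_ffunE scaler_suml; apply: eq_bigr => a _; rewrite ffunE scalerA.
Qed.

Lemma conv_tHH (u w : H) :
  \sum_(ab : I2) tHH u w ab *: (f (hbas ab.1) * f' (hbas ab.2)) = f u * f' w.
Proof.
rewrite {2}(hbas_sum u) {2}(hbas_sum w) !linear_sum mulr_suml.
under [RHS]eq_bigr => a _ do rewrite mulr_sumr.
rewrite pair_bigA; apply: eq_bigr => -[a b] _ /=.
by rewrite ffunE !linearZ /= -scalerAl -scalerAr scalerA.
Qed.

Lemma conv_nform g i : (i < n)%N -> conv f f' (nform D g i) =
  \sum_(j < i.+1) qbin t i j *: (f (nform D g j) * f' (nform D (g * z ^+ j)%g (i - j))).
Proof.
move=> lti; rewrite /conv comul_nform //.
under [RHS]eq_bigr => j _ do rewrite -conv_tHH scaler_sumr.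
rewrite exchange_big /=; apply: eq_bigr => ab _.
by rewrite sum_ffunE scaler_suml; apply: eq_bigr => j _; rewrite ffunE scalerA.
Qed.

(** Since [g] is group-like; it makes the values of a cleft map on [G] invertible. *)
Lemma conv_hg g : conv f f' (hg D g) = f (hg D g) * f' (hg D g).
Proof. by rewrite /conv comul_hg conv_tHH. Qed.

Lemma conv_counit :
  (forall g i, (i < n)%N -> conv f f' (nform D g i) = (i == 0%N)%:R *: 1) ->
  forall u, conv f f' u = counit u *: 1.
Proof.
move=> E u; rewrite conv_sum counit_sum scaler_suml; apply: eq_bigr => -[g i] _.
by rewrite hbasE E // counit_nform // scalerA.
Qed.

Lemma ga_H_sumZ (J : Type) (r : seq J) (c : J -> k) (T : J -> HH) :
  ga_H f (\sum_(j <- r) c j *: T j) = \sum_(j <- r) c j *: ga_H f (T j).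
Proof.
apply/ffunP => b; rewrite sum_ffunE ffunE.
have -> : [ffun a => (\sum_(j <- r) c j *: T j) (a, b)] =
    \sum_(j <- r) c j *: ([ffun a => T j (a, b)] : H).
  by apply/ffunP => a; rewrite !sum_ffunE ffunE sum_ffunE;
    apply: eq_bigr => j _; rewrite !ffunE.
by rewrite linear_sum; apply: eq_bigr => j _; rewrite linearZ /= !ffunE.
Qed.

Lemma H_ga_sumZ (J : Type) (r : seq J) (c : J -> k) (T : J -> HH) :
  H_ga f (\sum_(j <- r) c j *: T j) = \sum_(j <- r) c j *: H_ga f (T j).
Proof.
apply/ffunP => b; rewrite sum_ffunE ffunE.
have -> : [ffun a => (\sum_(j <- r) c j *: T j) (b, a)] =
    \sum_(j <- r) c j *: ([ffun a => T j (b, a)] : H).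
  by apply/ffunP => a; rewrite !sum_ffunE ffunE sum_ffunE;
    apply: eq_bigr => j _; rewrite !ffunE.
by rewrite linear_sum; apply: eq_bigr => j _; rewrite linearZ /= !ffunE.
Qed.

Lemma ga_H_tHH u w : ga_H f (tHH u w) = tVH (f u) w.
Proof.
apply/ffunP => b; rewrite !ffunE -linearZ; congr (f _).
by apply/ffunP => a; rewrite !ffunE /GRing.scale /= mulrC.
Qed.

Lemma H_ga_tHH u w : H_ga f (tHH u w) = tHV u (f w).
Proof.
apply/ffunP => b; rewrite !ffunE -linearZ; congr (f _).
by apply/ffunP => a; rewrite !ffunE.
Qed.

End Convolution.

(** * The product of [B (x) H_D] and the coefficients of [nu] *)

Section ComoduleAlgebra.
Variables (k : fieldType) (gT : finGroupType) (D : datum k gT).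
Variable B : algType k.

Local Notation I := (idx D).
Local Notation I2 := (idx D * idx D)%type.
Local Notation H := (HD D).
Local Notation ev h := (h : {ffun I -> k^o}).
Local Notation n := (ord D).
Local Notation z := (zc D).
Local Notation q := (qq D).
Local Notation p := (pp D).
Local Notation t := (qq D * chi D (zc D)).
Local Notation i0 := (i0 D).
Local Notation i1 := (i1 D).

Variable s : {linear {ffun I -> B} -> {ffun I -> B}}.
Variable nu : {linear B -> {ffun I -> B}}.
Hypothesis hB : comodule_algebra s nu.
Let hs : left_transposition s := ca_transp hB.

(* the product of [B (x) H_D] twisted by [s] *)
Definition mulBH (u v : {ffun I -> B}) := ampl (@mulH _ _ D) (muB_s_H s u v).

Lemma nuM b b' : nu (b * b') = mulBH (nu b) (nu b').
Proof. exact: ca_nu_mul hB b b'. Qed.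

Lemma mulBH_pure v w v' v'' w' : swaps s w v' v'' ->
  mulBH (tVH v w) (tVH v' w') = tVH (v * v'') (w * w').
Proof.
move=> sw; rewrite -[RHS]/(tHV _ _) -ampl_mulH_pure; congr (ampl _ _).
apply/ffunP => xy; rewrite [LHS]ffunE -[tVH v w]/(tHV w v) muB_s_pure //.
rewrite [tVH v' w' _]ffunE tHVZr linearZ sw !ffunE -!scalerAr scalerA.
by rewrite [X in X *: _]mulrC.
Qed.

Lemma mulBH1l v u : mulBH (tVH v 1) u = [ffun a => v * u a].
Proof.
rewrite /mulBH.
have -> : muB_s_H s (tVH v 1) u =
    [ffun xy : I2 => ev (1 : H) xy.1 *: [ffun a => v * u a] xy.2].
  apply/ffunP => xy; rewrite [LHS]ffunE -[tVH v 1]/(tHV 1 v) muB_s_pure //.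
  by rewrite !ffunE (lt_one hs) ffunE scalerAr.
rewrite ampl_mulH_l [RHS]ffun_tHV_sum.
by apply: eq_bigr => a _; rewrite mul1r.
Qed.

Lemma mulBH_sumZl (J : Type) (r : seq J) (c : J -> k) (T : J -> {ffun I -> B}) u :
  mulBH (\sum_(j <- r) c j *: T j) u = \sum_(j <- r) c j *: mulBH (T j) u.
Proof.
apply/ffunP => y; rewrite sum_ffunE ffunE.
under [RHS]eq_bigr => j _ do rewrite !ffunE scaler_sumr.
rewrite exchange_big; apply: eq_bigr => xy _ /=.
under [RHS]eq_bigr => j _ do rewrite scalerA mulrC -scalerA.
rewrite -scaler_sumr; congr (_ *: _); rewrite !ffunE.
under [RHS]eq_bigr => j _ do rewrite !ffunE scaler_sumr.
rewrite exchange_big; apply: eq_bigr => a _ /=.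
rewrite sum_ffunE mulr_suml; apply: eq_bigr => j _.
by rewrite ffunE scalerAl.
Qed.

Lemma mulBHDr u v w : mulBH u (v + w) = mulBH u v + mulBH u w.
Proof.
rewrite /mulBH -ampl_morphD; congr (ampl _ _); apply/ffunP => xy.
rewrite !ffunE -big_split; apply: eq_bigr => a _ /=.
have -> : tHV (hbas a) (v xy.2 + w xy.2) =
    tHV (hbas a) (v xy.2) + tHV (hbas a) (w xy.2).
  by apply/ffunP => b; rewrite !ffunE scalerDr.
by rewrite linearD ffunE mulrDr.
Qed.

Lemma nu_coassoc b (x y : I) (i : 'I_n) : i = (x.2 + y.2)%N :> nat ->
  nu (nu b y) x = (qbin t i x.2 *: nu b (x.1, i)) *+ (y.1 == x.1 * z ^+ x.2)%g.
Proof.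
move=> ei; rewrite -(ampl_comul (nu b) ei).
have -> : nu (nu b y) x = nu_H nu (nu b) (x, y) by rewrite ffunE.
by rewrite (ca_coassoc hB).
Qed.

(** Coassociativity in degrees [l'] and [1], divided by the nonzero [qbin t l l']. Thus the higher
    coefficients of [nu b] are determined by those in degree one. *)
Lemma nu_step b h (l l' : 'I_n) : l = l'.+1 :> nat ->
  nu b (h, l) = (qbin t l l')^-1 *: nu (nu b ((h * z ^+ l')%g, i1)) (h, l').
Proof.
move=> el; rewrite (@nu_coassoc _ (h, l') _ l) /= ?addn1 // eqxx mulr1n.
by rewrite scalerA mulVf ?scale1r // qbin_pred_idx_neq0.
Qed.

(** * The coaction on homogeneous elements of [B] *)

Section Graded.
Variables (g : gT) (b : B).
Hypothesis hb : Bgz s nu g id b.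

(** Coassociativity in degree [0] makes [U^g_0] idempotent. *)
Lemma nu_Bgz0 : nu b (g, i0) = b.
Proof.
case: hb => -[b' eb] _; rewrite {1}eb /Ugi (@nu_coassoc _ (g, i0) _ i0) //=.
by rewrite mulg1 eqxx qbin0 scale1r mulr1n.
Qed.

(** With [b = U^g_0(b')], coassociativity pairs [h x^i] with [g] only if [g = h z^i]. *)
Lemma nu_Bgz h (i : 'I_n) : (g != h * z ^+ i)%g -> nu b (h, i) = 0.
Proof.
case: hb => -[b' eb] _ ng; rewrite eb /Ugi (@nu_coassoc _ (h, i) _ i) ?addn0 //=.
by rewrite (negPf ng) mulr0n.
Qed.

Lemma Umap_Bgz : Umap nu b = nu b ((g * z^-1)%g, i1).
Proof.
rewrite /Umap (bigD1 (g * z^-1)%g) //= big1 ?addr0 // => h nh.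
apply: nu_Bgz; apply: contra nh => /eqP ->.
by rewrite /= expg1 mulgK.
Qed.

(** All degree-one coefficients vanish, and [nu_step] propagates this to higher degrees. *)
Lemma nu_ker_Umap : Umap nu b = 0 -> nu b = tVH b (hg D g).
Proof.
move=> U0.
have nu1 h : nu b (h, i1) = 0.
  have [eg|ng] := eqVneq g (h * z)%g; last by rewrite nu_Bgz.
  by rewrite -U0 Umap_Bgz eg mulgK.
apply/ffunP => -[h i]; rewrite ffunE hg_coef /=.
case ei: (i : nat) => [|m].
  have -> : i = i0 by apply: val_inj.
  have [gh|ng] := eqVneq g h; first by rewrite -gh nu_Bgz0 scale1r.
  by rewrite scale0r nu_Bgz //= mulg1.
have ltm : (m < n)%N by apply: ltn_trans (ltn_ord i); rewrite ei.
rewrite andbF scale0r (@nu_step _ _ _ (Ordinal ltm)) // nu1.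
by rewrite linear0 ffunE scaler0.
Qed.

Lemma swaps_Bgz h : swaps s (hg D h) b b.
Proof. by case: hb => _; apply. Qed.

End Graded.

(** In degree one only [x] occurs, with coefficient [1]. By [nu_step] the coefficients in degree at
    least [2] come from those of [nu 1 = 1 (x) 1] in positive degree, hence vanish. *)
Lemma nu_Umap1 b : Bgz s nu z id b -> Umap nu b = 1 ->
  nu b = tVH 1 (hx D) + tVH b (hg D z).
Proof.
move=> hb U1.
have nu1 h : nu b (h, i1) = 1 *+ (h == 1)%g.
  have [->|nh] := eqVneq h 1%g.
    by rewrite -U1 (Umap_Bgz hb) mulgV.
  rewrite (nu_Bgz hb) //= expg1; apply: contra nh => /eqP zh.
  by apply/eqP/(mulIg z); rewrite -zh mul1g.
apply/ffunP => -[h i]; rewrite !ffunE hg_coef hx_coef /=.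
case ei: (i : nat) => [|[|m]].
- have -> : i = i0 by apply: val_inj.
  rewrite andbF scale0r add0r andbT.
  have [<-|ng] := eqVneq z h; first by rewrite (nu_Bgz0 hb) scale1r.
  by rewrite scale0r (nu_Bgz hb) //= mulg1.
- have -> : i = i1 by apply: val_inj.
  by rewrite nu1 andbF scale0r addr0 andbT scaler_nat.
have ltm : (m.+1 < n)%N by apply: leq_trans (ltn_ord i); rewrite ei.
rewrite !andbF !scale0r addr0 (@nu_step _ _ _ (Ordinal ltm)) // nu1.
rewrite linearMn /= (ca_nu_one hB) /tVH.
set e := (_ == _).
have -> : ([ffun a => ev (1 : H) a *: (1 : B)] *+ e) (h, Ordinal ltm) = 0.
  by case: e; rewrite ?mulr1n ?mulr0n ffunE // h1_coef andbF scale0r.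
by rewrite scaler0.
Qed.

Lemma alpha_swaps b b' : swaps s (hx D) b b' -> alpha s b = b'.
Proof. by move=> sx; rewrite /alpha sx ffunE hx_coef !eqxx scale1r. Qed.

(** Pulling [b] out of [s (h (x) b b')] gives [1 (x) h = b s (h (x) b')]; multiply by [b'] on the
    left. *)
Lemma swaps_inv h b b' : inverse_of b b' -> swaps s h b b -> swaps s h b' b'.
Proof.
case=> bb' b'b sb; have := lt_mulB hs h b b'.
rewrite bb' (lt_oneB hs) sb muB_s_pure // => E; apply/ffunP => a.
have /(congr1 (fun x => b' * x)) := congr1 (fun v : {ffun I -> B} => v a) E.
by rewrite !ffunE mulrA b'b mul1r -scalerAr mulr1 => ->.
Qed.

(** As [b] is coinvariant, [1 (x) 1 = nu (b b') = b nu (b')]; multiply by [b'] on the left. *)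
Lemma nu_inv_coinv b b' : inverse_of b b' -> nu b = tVH b 1 -> nu b' = tVH b' 1.
Proof.
case=> bb' b'b nb; have := nuM b b'; rewrite bb' (ca_nu_one hB) nb mulBH1l => E.
apply/ffunP => a; have /(congr1 (fun x => b' * x)) :=
  congr1 (fun v : {ffun I -> B} => v a) E.
by rewrite !ffunE mulrA b'b mul1r -scalerAr mulr1 => <-.
Qed.

(** * From a cleft family to a cleft map and its convolution inverse *)

Section CleftMap.
Variables (bx : B) (b : gT -> B).
Hypothesis hpq : (p, q) <> (1, -1).
Hypothesis hb : cleft_family s nu bx b.

Lemma swaps_bg g i h : swaps s (nform D h i) (b g) (b g).
Proof.
have [bg U0] := cf_bg hb g.
have := @swaps_nform _ _ _ _ _ hs h i (b g) 1; rewrite expr1n !scale1r; apply.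
  exact: swaps_Bgz bg.
rewrite -[X in swaps _ _ _ X]scale1r; apply: swaps_hx (oner_neq0 _) => //.
  exact: swaps_Bgz bg.
by rewrite (cf_alpha_bg hb) scale1r.
Qed.

Lemma swaps_bx i h : swaps s (nform D h i) bx (q ^+ i *: bx).
Proof.
have [bz U1] := cf_bx hb.
apply: swaps_nform => //; first exact: swaps_Bgz bz.
apply: swaps_hx (qq_neq0 D) => //; first exact: swaps_Bgz bz.
exact: cf_alpha_bx hb.
Qed.

Lemma swaps_bg_bx g j i h :
  swaps s (nform D h i) (b g * bx ^+ j) (q ^+ (i * j) *: (b g * bx ^+ j)).
Proof.
rewrite scalerAr; apply: swaps_mulB (swaps_bg g i h) _ => //.
elim: j => [|j IH]; first by rewrite muln0 !expr0 scale1r; apply: swaps_oneB.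
rewrite !exprS mulnS exprD -scalerA [X in _ ^+ i *: X]scalerAr scalerAl.
by apply: swaps_mulB => //; apply: swaps_bx.
Qed.

(** The same expansion as in [comul_nform], multiplying on the right by
    [nu b_x = 1 (x) x + b_x (x) z]. Moving [x^(i-j)] past [b_x] gives [q ^+ (i - j)] and past [z]
    gives [chi(z) ^+ (i - j)], together [t ^+ (i - j)]. *)
Lemma nu_bg_bx g i : nu (b g * bx ^+ i) =
  \sum_(j < i.+1) qbin t i j *: tVH (b g * bx ^+ j) (nform D (g * z ^+ j)%g (i - j)).
Proof.
elim: i => [|i IH].
  have [bg U0] := cf_bg hb g.
  rewrite big_ord1 qbin0 scale1r !expr0 !mulr1 mulg1 subnn.
  exact: nu_ker_Umap bg U0.
have [bz U1] := cf_bx hb.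
rewrite exprSr mulrA nuM IH mulBH_sumZl (nu_Umap1 bz U1).
rewrite (qbin_sumS _
  (fun j => tVH (b g * bx ^+ j) (nform D (g * z ^+ j)%g (i.+1 - j)))).
apply: eq_bigr => j _; have lej : (j <= i)%N by rewrite -ltnS.
congr (_ *: _); rewrite mulBHDr (mulBH_pure _ _ (swaps_oneB hs _)) mulr1.
rewrite (mulBH_pure _ _ (swaps_bx _ _)) !nformM chi1 expr1n scale1r mulg1.
rewrite addn1 addn0 -subSn //; congr (_ + _).
rewrite -mulgA -expgSr subSS -scalerAr exprSr mulrA.
by rewrite /tVH -[LHS]/(tHV _ _) tHVZ tHVZr scalerA exprMn mulrC.
Qed.

Let ga : {linear H -> B} := linext (D := D) (fun g i => b g * bx ^+ i).

Lemma ga_nform g i : (i < n)%N -> ga (nform D g i) = b g * bx ^+ i.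
Proof. by move=> lti; rewrite -hg_hxX [LHS]linextE. Qed.

Lemma colinear_ga h : nu (ga h) = ga_H ga (comul h).
Proof.
have nuga u : nu (ga u) = (nu \o ga) u by [].
rewrite comul_sum ga_H_sumZ nuga (linear_hbas _ h).
apply: eq_bigr => -[g i] _; congr (_ *: _).
rewrite hbasE -[LHS]/(nu (ga _)) ga_nform // nu_bg_bx comul_nform // ga_H_sumZ.
apply: eq_bigr => j _; rewrite ga_H_tHH ga_nform //.
by apply: leq_ltn_trans (ltn_ord i); rewrite -ltnS.
Qed.

Lemma braid_ga v : ga_H ga (braidH v) = s (H_ga ga v).
Proof.
rewrite {2}(tHH_sum v) H_ga_sumZ linear_sum /braidH ga_H_sumZ.
apply: eq_bigr => -[[g i] [h j]] _; rewrite linearZ /= ga_H_tHH H_ga_tHH.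
rewrite !hbasE /= ga_nform // swaps_bg_bx tHVZr scalerA mulrC.
by [].
Qed.

Variable binv : gT -> B.
Hypothesis hbinv : forall g, inverse_of (b g) (binv g).

Let gai : {linear H -> B} := linext (D := D) (fun g i =>
  ((-1) ^+ i * (qq D * pp D) ^+ ((i * (i - 1)) %/ 2)%N) *:
    (bx ^+ i * binv (g * zc D ^+ i)%g)).

Lemma gai_nform g i : (i < n)%N ->
  gai (nform D g i) = qsgn t i *: (bx ^+ i * binv (g * z ^+ i)%g).
Proof. by move=> lti; rewrite -hg_hxX [LHS]linextE. Qed.

(** The shifts by powers of [z] match, so all terms of a convolution sum involve one element:
    [b_g b_x^i b_(g z^i)^-1] on one side, [b_x^i] on the other. The scalars form an alternating sum,
    which is [0] unless [i = 0]. *)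
Lemma conv_inverse_ga : conv_inverse (D := D) ga gai.
Proof.
split; apply: conv_counit => g i lti; rewrite conv_nform //.
- have E (j : 'I_i.+1) : qbin t i j *:
      (ga (nform D g j) * gai (nform D (g * z ^+ j)%g (i - j))) =
      (qbin t i j * qsgn t (i - j)) *: (b g * bx ^+ i * binv (g * z ^+ i)%g).
    have lej : (j <= i)%N by rewrite -ltnS.
    rewrite ga_nform ?(leq_ltn_trans lej) //.
    rewrite gai_nform ?(leq_ltn_trans (leq_subr _ _)) //.
    rewrite -scalerAr scalerA -mulgA -expgD subnKC // !mulrA.
    by rewrite -(mulrA (b g) (bx ^+ j)) -exprD subnKC.
  under eq_bigr => j _ do rewrite E.
  rewrite -scaler_suml qbin_altr; case: i {lti E} => [|i]; last by rewrite !scale0r.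
  by rewrite expr0 mulr1 mulg1 (hbinv g).1.
have E (j : 'I_i.+1) : qbin t i j *:
    (gai (nform D g j) * ga (nform D (g * z ^+ j)%g (i - j))) =
    (qbin t i j * qsgn t j) *: bx ^+ i.
  have lej : (j <= i)%N by rewrite -ltnS.
  rewrite gai_nform ?(leq_ltn_trans lej) //.
  rewrite ga_nform ?(leq_ltn_trans (leq_subr _ _)) //.
  rewrite -scalerAl scalerA -mulrA (mulrA (binv _)) (hbinv _).2 mul1r -exprD.
  by rewrite subnKC.
under eq_bigr => j _ do rewrite E.
rewrite -scaler_suml qbin_alt; case: i {lti E} => [|i]; last by rewrite !scale0r.
by rewrite expr0.
Qed.

End CleftMap.

(** * From a cleft map to a cleft family *)

Lemma cleft_family_of_cleft_map (ga : {linear H -> B}) : cleft_map s nu ga ->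
  exists (bx : B) (b : gT -> B), cleft_family s nu bx b.
Proof.
case=> col [ga' [inv1 inv2]] br.
have inv g : inverse_of (ga (hg D g)) (ga' (hg D g)).
  have c1 : counit (hg D g) = 1 := counit_nform g (ord_gt0 D).
  by split; rewrite -conv_hg ?inv1 ?inv2 c1 scale1r.
(* The braid condition on a pair of basis elements; the cases with [g] and [x] give all commutation
   rules below. *)
have sw (a a' : I) :
    swaps s (hbas a) (ga (hbas a')) (q ^+ (a.2 * a'.2) *: ga (hbas a')).
  by rewrite /swaps -H_ga_tHH -br braidH_tHH -tHHZl ga_H_tHH linearZ.
have hgE g : hg D g = hbas (g, i0) by apply: nform_hbas.
have hxE : hx D = hbas (1%g, i1) by apply: nform_hbas.
have swg g g' : swaps s (hg D g) (ga (hg D g')) (ga (hg D g')).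
  by have := sw (g, i0) (g', i0); rewrite -!hgE expr0 scale1r.
have swgx g : swaps s (hg D g) (ga (hx D)) (ga (hx D)).
  by have := sw (g, i0) (1%g, i1); rewrite -hgE -hxE expr0 scale1r.
have swxg g : swaps s (hx D) (ga (hg D g)) (ga (hg D g)).
  by have := sw (1%g, i1) (g, i0); rewrite -hgE -hxE muln0 expr0 scale1r.
have swx : swaps s (hx D) (ga (hx D)) (q *: ga (hx D)).
  by have := sw (1%g, i1) (1%g, i1); rewrite -hxE expr1.
have nug g : nu (ga (hg D g)) = tVH (ga (hg D g)) (hg D g).
  by rewrite col comul_hg ga_H_tHH.
(* [gamma(1)] is an invertible coinvariant that need not be [1]. Dividing [nu (gamma x) = gamma(1)
   (x) x + gamma(x) (x) z] by it on the left normalises the coefficient of [x] to [1], that is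
   [U b_x = 1]. *)
pose c' := ga' (hg D 1); have invc : inverse_of (ga (hg D 1)) c' := inv 1%g.
pose bx := c' * ga (hx D).
have nux : nu bx = tVH 1 (hx D) + tVH bx (hg D z).
  rewrite nuM (nu_inv_coinv invc (nug 1%g)) mulBH1l col comul_hx.
  have -> : ga_H ga (tHH 1 (hx D) + tHH (hx D) (hg D z)) =
      tVH (ga 1) (hx D) + tVH (ga (hx D)) (hg D z).
    rewrite -!ga_H_tHH; apply/ffunP => a; rewrite !ffunE -linearD; congr (ga _).
    by apply/ffunP => a'; rewrite !ffunE.
  apply/ffunP => a; rewrite !ffunE mulrDr -!scalerAr -[1 : H]hg1 invc.2.
  by [].
exists bx, (fun g => ga (hg D g)); split=> [g|g|||g].
- by exists (ga' (hg D g)).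
- split; last by rewrite /Umap big1 // => h _; rewrite /Ugi nug ffunE hg_coef andbF scale0r.
  split; last by move=> h; apply: swg.
  by exists (ga (hg D g)); rewrite /Ugi nug ffunE hg_coef !eqxx scale1r.
- split; last first.
    rewrite /Umap (bigD1 1%g) //= big1 => [|h nh].
      by rewrite /Ugi nux !ffunE hx_coef hg_coef andbF scale0r !addr0 !eqxx scale1r.
    by rewrite /Ugi nux !ffunE hx_coef hg_coef (negPf nh) andbF !scale0r addr0.
  split; last by move=> h; apply: swaps_mulB => //; apply: swaps_inv invc _.
  by exists bx; rewrite /Ugi nux !ffunE hx_coef hg_coef andbF scale0r add0r !eqxx scale1r.
- apply: alpha_swaps; rewrite scalerAr; apply: swaps_mulB => //.
  exact: swaps_inv invc _.
- exact: alpha_swaps.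
Qed.

End ComoduleAlgebra.

(** * The equivalence and the explicit cleft map *)

Theorem theorem4p1 (k : fieldType) (gT : finGroupType) (D : datum k gT)
    (hpq : (pp D, qq D) <> (1, -1))
    (B : algType k)
    (s : {linear {ffun idx D -> B} -> {ffun idx D -> B}})
    (nu : {linear B -> {ffun idx D -> B}})
    (hB : comodule_algebra s nu) :
  (cleft s nu <->
     exists (bx : B) (b : gT -> B), cleft_family s nu bx b) /\
  (forall (bx : B) (b : gT -> B), cleft_family s nu bx b ->
     cleft_map s nu (linext (fun g i => b g * bx ^+ i)) /\
     forall binv : gT -> B, (forall g, inverse_of (b g) (binv g)) ->
       conv_inverse (D := D)
         (linext (fun g i => b g * bx ^+ i))
         (linext (fun g i =>
            ((-1) ^+ i * (qq D * pp D) ^+ ((i * (i - 1)) %/ 2)%N) *: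
              (bx ^+ i * binv (g * zc D ^+ i)%g)))).
Proof.
have toM bx b : cleft_family s nu bx b ->
    cleft_map s nu (linext (fun g i => b g * bx ^+ i)) /\
    forall binv : gT -> B, (forall g, inverse_of (b g) (binv g)) ->
      conv_inverse (D := D)
        (linext (fun g i => b g * bx ^+ i))
        (linext (fun g i =>
           ((-1) ^+ i * (qq D * pp D) ^+ ((i * (i - 1)) %/ 2)%N) *:
             (bx ^+ i * binv (g * zc D ^+ i)%g))).
  move=> hb; split=> [|binv hbinv]; last exact: (conv_inverse_ga D bx hbinv).
  (* Inverses are chosen as a function on [G]; stating the equations as booleans lets [xchoose] do
     this. *)
  have ub g : exists b', (b g * b' == 1) && (b' * b g == 1).
    by have [b' [e1 e2]] := cf_unit hb g; exists b'; rewrite e1 e2 !eqxx.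
  pose binv g := xchoose (ub g).
  have hbinv g : inverse_of (b g) (binv g).
    by have /andP[/eqP e1 /eqP e2] := xchooseP (ub g).
  split=> [h||v]; [exact: (colinear_ga hB hpq hb)| |exact: (braid_ga hB hpq hb)].
  by eexists; apply: (conv_inverse_ga D bx hbinv).
split=> //; split=> [[ga hga]|[bx [b hb]]]; last first.
  by eexists; apply: (toM _ _ hb).1.
exact: cleft_family_of_cleft_map hB _ hga.
Qed.
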